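(* Let $k\geq 3$ and $d\geq 3$. Every $(k+d-1,7^k,d)_7$ code and every $(k+d-1,5^k,d)_5$ code is equivalent to a linear code.
   Context: An $(n,M,d)_q$ code is a subset of $\mathcal{A}^n$, where $\mathcal{A}$ is an alphabet of size $q$ (here identified with the field $\mathbb{F}_q$), having $M$ elements and minimum Hamming distance $d$. Two codes of length $n$ are equivalent if one can be obtained from the other by a permutation of the coordinates followed by a permutation of the symbols in each coordinate separately (possibly different permutations in different coordinates). A code is linear if it is an $\mathbb{F}_q$-linear subspace of $\mathbb{F}_q^n$. *)

(* Defs.v *)
From mathcomp Require Import all_boot all_order all_algebra all_fingroup.
Set Implicit Arguments. Unset Strict Implicit. Unset Printing Implicit Defensive.
Import GRing.Theory.
Local Open Scope ring_scope.

Definition hdist (F : finFieldType) (n : nat) (x y : 'rV[F]_n) : nat :=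
  #|[set i : 'I_n | x 0 i != y 0 i]|.

Definition has_min_dist (F : finFieldType) (n : nat) (C : {set 'rV[F]_n}) (d : nat) : Prop :=
  (exists x y, [/\ x \in C, y \in C, x != y & hdist x y = d]) /\
  (forall x y, x \in C -> y \in C -> x != y -> (d <= hdist x y)%N).

Definition is_code (F : finFieldType) (n M d : nat) (C : {set 'rV[F]_n}) : Prop :=
  #|C| = M /\ has_min_dist C d.

Definition linear_code (F : finFieldType) (n : nat) (C : {set 'rV[F]_n}) : Prop :=
  0 \in C /\ (forall (a : F) x y, x \in C -> y \in C -> a *: x + y \in C).

Definition code_equiv (F : finFieldType) (n : nat) (C D : {set 'rV[F]_n}) : Prop :=
  exists (s : 'S_n) (pi : 'I_n -> {perm F}),
    D = [set (\row_j (pi j) (x 0 (s j))) | x : 'rV[F]_n in C].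
Arguments is_code {F} n M d C.

(* Main.v *)
(** Over 5 or 7 symbols, a set of words is MDS of dimension [k] when every [k]
    positions carry each [k]-tuple of symbols exactly once.  Fixing all but two
    (all but three) information symbols of the code leaves MDS sets which,
    restricted to four (five) coordinates, we call planes (cubes).

    A plane splits into the lines on which the last coordinate is constant.  Two
    of its lines amount to a pair of permutations, which up to relabelling is one
    of a short list; completing each pair in every possible way shows that each
    plane is, with a prescribed line sent to the diagonal, one of finitely many
    normal forms.  A second search shows that no cube contains a non-linear normal
    form, and that the labels turning one plane of a cube into a linear plane also
    turn the planes meeting it in a line into linear planes.

    Labels with [l x + m y = t z] on a plane are unique up to affine maps, because
    [f a + g b = h (a + b)] forces [f] to be affine over a prime field.  Walking
    through adjacent planes therefore gives one label per coordinate, for which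
    every parity symbol is affine in any two information symbols; hence its slopes
    are constant, and the relabelled code is affine. *)

Require Import Defs.
From mathcomp Require Import all_boot all_order all_algebra all_fingroup.
From mathcomp Require Import zify ring.

Set Implicit Arguments.
Unset Strict Implicit.
Unset Printing Implicit Defensive.

Import GRing.Theory.

(** * Words and relabellings *)

Notation word := (seq nat) (only parsing).
Notation table := (seq nat) (only parsing).
Notation ap := (nth 0).
Notation tab := (nth [::]).

Definition perm_table n (t : table) : bool := perm_eq t (iota 0 n).

Definition comp_table (s t : table) : table := [seq ap s x | x <- t].

Lemma perm_table_iota n : perm_table n (iota 0 n).
Proof. exact: perm_refl. Qed.

Lemma nth_iota0 n x : x < n -> ap (iota 0 n) x = x.
Proof. by move=> lt_xn; rewrite nth_iota. Qed.

Lemma mem_iota0 n x : (x \in iota 0 n) = (x < n).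
Proof. by rewrite mem_iota. Qed.

Lemma nth_map_iota (T : Type) (x0 : T) (f : nat -> T) n x :
  x < n -> nth x0 [seq f i | i <- iota 0 n] x = f x.
Proof. exact: nth_mkseq. Qed.

Lemma nth_comp_table s t x : x < size t -> ap (comp_table s t) x = ap s (ap t x).
Proof. by move=> lt_xt; rewrite (nth_map 0). Qed.

Section PermTable.
Variables (n : nat) (t : table).
Hypothesis perm_t : perm_table n t.

Lemma perm_table_size : size t = n.
Proof. by rewrite (perm_size perm_t) size_iota. Qed.

Lemma perm_table_uniq : uniq t.
Proof. by rewrite (perm_uniq perm_t) iota_uniq. Qed.

Lemma mem_perm_table x : (x \in t) = (x < n).
Proof. by rewrite (perm_mem perm_t) mem_iota0. Qed.

Lemma perm_table_lt x : x < n -> ap t x < n.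
Proof. by move=> lt_xn; rewrite -mem_perm_table mem_nth ?perm_table_size. Qed.

Lemma perm_table_inj x y : x < n -> y < n -> ap t x = ap t y -> x = y.
Proof.
by move=> lt_xn lt_yn /eqP; rewrite nth_uniq ?perm_table_size ?perm_table_uniq // => /eqP.
Qed.

Lemma perm_table_index x : x < n -> ap t (index x t) = x.
Proof. by move=> lt_xn; rewrite nth_index ?mem_perm_table. Qed.

Lemma perm_table_index_lt x : x < n -> index x t < n.
Proof. by move=> lt_xn; rewrite -[ltnRHS]perm_table_size index_mem mem_perm_table. Qed.

Lemma perm_table_indexK x : x < n -> index (ap t x) t = x.
Proof. by move=> lt_xn; rewrite index_uniq ?perm_table_size ?perm_table_uniq. Qed.
End PermTable.

Lemma perm_tableI n t : size t = n -> {in gtn n, forall x, ap t x < n} ->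
  {in gtn n &, injective (ap t)} -> perm_table n t.
Proof.
move=> size_t lt_t inj_t.
have uniq_t : uniq t by apply/(uniqP 0); rewrite size_t.
have sub_t : {subset t <= iota 0 n}.
  by move=> _ /(nthP 0)[x lt_x <-]; rewrite mem_iota0 lt_t // -size_t.
have [|_ eq_mem] := uniq_min_size uniq_t sub_t; first by rewrite size_t size_iota.
by rewrite /perm_table uniq_perm ?iota_uniq.
Qed.

Lemma perm_comp_table n s t :
  perm_table n s -> perm_table n t -> perm_table n (comp_table s t).
Proof.
move=> perm_s perm_t; have size_t := perm_table_size perm_t.
apply: perm_tableI => [|x lt_x|x y lt_x lt_y]; first by rewrite size_map.
  by rewrite nth_comp_table ?size_t // !perm_table_lt.
rewrite !nth_comp_table ?size_t // => /(perm_table_inj perm_s) eq_t.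
by apply: (perm_table_inj perm_t) => //; apply: eq_t; apply: perm_table_lt.
Qed.

Lemma comp_table_iota n t : perm_table n t -> comp_table (iota 0 n) t = t.
Proof.
move=> perm_t; rewrite /comp_table -[RHS]map_id; apply/eq_in_map => x.
by rewrite (mem_perm_table perm_t) => /nth_iota0.
Qed.

Definition swap0_table n a : table :=
  [seq if x == 0 then a else if x == a then 0 else x | x <- iota 0 n].

Lemma nth_swap0_table n a : 0 < n -> ap (swap0_table n a) 0 = a.
Proof. by move=> gt0_n; rewrite nth_map_iota. Qed.

Lemma perm_swap0_table n a : a < n -> perm_table n (swap0_table n a).
Proof.
move=> lt_an; have gt0_n : 0 < n by apply: leq_ltn_trans lt_an.
apply: perm_tableI => [|x lt_x|x y lt_x lt_y]; first by rewrite size_map size_iota.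
  by rewrite nth_map_iota //; do 2?case: ifP.
rewrite !nth_map_iota //; do 4?case: eqP => //; congruence.
Qed.

Definition over n q (w : word) : bool := (size w == n) && all (gtn q) w.

Lemma overP n q w :
  reflect (size w = n /\ forall i, i < n -> ap w i < q) (over n q w).
Proof.
apply: (iffP andP) => [[/eqP <- /(all_nthP 0)]|[<- lt_w]] //.
by split=> //; apply/(all_nthP 0).
Qed.

(* The symbol in position [s i] is moved to position [i] and renamed by [g i]. *)
Definition relabel (s : seq nat) (g : seq table) (w : word) : word :=
  [seq ap (tab g i) (ap w (ap s i)) | i <- iota 0 (size s)].

Definition relabelling n q (s : seq nat) (g : seq table) : bool :=
  [&& perm_table n s, size g == n & all (perm_table q) g].

Lemma relabellingP n q s g : reflect
  [/\ perm_table n s, size g = n & forall i, i < n -> perm_table q (tab g i)]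
  (relabelling n q s g).
Proof.
apply: (iffP and3P) => [[perm_s /eqP size_g /(all_nthP [::])]|[perm_s /eqP size_g perm_g]].
  by rewrite size_g.
by split=> //; apply/(all_nthP [::]); rewrite (eqP size_g).
Qed.

Lemma nth_relabel s g w i :
  i < size s -> ap (relabel s g w) i = ap (tab g i) (ap w (ap s i)).
Proof. exact: nth_map_iota. Qed.

Lemma relabel_comp n q s g s' g' h w :
  perm_table n s -> perm_table n s' -> over n q w ->
  (forall i x, i < n -> x < q -> ap (tab h i) x = ap (tab g i) (ap (tab g' (ap s i)) x)) ->
  relabel s g (relabel s' g' w) = relabel (comp_table s' s) h w.
Proof.
move=> perm_s perm_s' /overP[_ lt_w] def_h.
have [size_s size_s'] := (perm_table_size perm_s, perm_table_size perm_s').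
rewrite /relabel size_map size_s; apply/eq_in_map => i; rewrite mem_iota0 => lt_i.
have lt_si := perm_table_lt perm_s lt_i.
rewrite size_s' nth_map_iota // nth_comp_table ?size_s // def_h //.
by rewrite lt_w // perm_table_lt.
Qed.

Lemma relabel_nseq n s t a : perm_table n s -> relabel s (nseq n t) (nseq n a) = nseq n (ap t a).
Proof.
move=> perm_s; have size_s := perm_table_size perm_s.
apply: (@eq_from_nth _ 0) => [|i]; rewrite size_map size_iota size_s ?size_nseq // => lt_i.
by rewrite nth_relabel ?size_s // !nth_nseq lt_i (perm_table_lt perm_s).
Qed.

Lemma relabel_id n q w : over n q w -> relabel (iota 0 n) (nseq n (iota 0 q)) w = w.
Proof.
case/overP=> size_w lt_w; apply: (@eq_from_nth _ 0) => [|i].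
  by rewrite size_map !size_iota size_w.
rewrite size_map !size_iota => lt_i.
by rewrite nth_relabel ?size_iota // nth_nseq lt_i !nth_iota0 ?lt_w.
Qed.

Section Relabelling.
Variables (n q : nat) (s : seq nat) (g : seq table).
Hypothesis sg : relabelling n q s g.

Let perm_s : perm_table n s. Proof. by case/relabellingP: sg. Qed.
Let size_s : size s = n := perm_table_size perm_s.
Let perm_g i : i < n -> perm_table q (tab g i). Proof. by case/relabellingP: sg => _ _; apply. Qed.

Lemma size_relabel w : size (relabel s g w) = n.
Proof. by rewrite size_map size_iota. Qed.

Lemma over_relabel w : over n q w -> over n q (relabel s g w).
Proof.
case/overP=> _ lt_w; apply/overP; split=> [|i lt_i]; first exact: size_relabel.
by rewrite nth_relabel ?size_s // (perm_table_lt (perm_g lt_i)) // lt_w // perm_table_lt.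
Qed.

Lemma index_relabel w i : over n q w -> i < n ->
  index (ap (relabel s g w) i) (tab g i) = ap w (ap s i).
Proof.
case/overP=> _ lt_w lt_i; rewrite nth_relabel ?size_s //.
by rewrite (perm_table_indexK (perm_g lt_i)) // lt_w // perm_table_lt.
Qed.

Lemma relabel_inj w v : over n q w -> over n q v -> relabel s g w = relabel s g v -> w = v.
Proof.
move=> ow ov eq_r; have [[size_w _] [size_v _]] := (overP _ _ _ ow, overP _ _ _ ov).
apply: (@eq_from_nth _ 0) => [|i]; rewrite size_w ?size_v // => lt_i.
rewrite -(perm_table_index perm_s lt_i).
by rewrite -!index_relabel ?eq_r ?(perm_table_index_lt perm_s).
Qed.

Lemma relabel_surj u : over n q u -> exists2 w, over n q w & relabel s g w = u.
Proof.
case/overP=> size_u lt_u.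
exists [seq index (ap u (index i s)) (tab g (index i s)) | i <- iota 0 n].
  apply/overP; split=> [|i lt_i]; first by rewrite size_map size_iota.
  have lt_j := perm_table_index_lt perm_s lt_i.
  by rewrite nth_map_iota // (perm_table_index_lt (perm_g lt_j)) ?lt_u.
apply: (@eq_from_nth _ 0) => [|j]; rewrite size_relabel // => lt_j.
rewrite nth_relabel ?size_s // nth_map_iota ?perm_table_lt // (perm_table_indexK perm_s lt_j).
by rewrite (perm_table_index (perm_g lt_j)) // lt_u.
Qed.
End Relabelling.

Definition insert (T : Type) i (a : T) (w : seq T) : seq T := take i w ++ a :: drop i w.
Definition omit (T : Type) i (w : seq T) : seq T := take i w ++ drop i.+1 w.

Section Insert.
Variable T : Type.
Implicit Types (a : T) (w : seq T).

Lemma size_insert i a w : size (insert i a w) = (size w).+1.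
Proof. by rewrite size_cat /= addnS -size_cat cat_take_drop. Qed.

Lemma nth_insert x0 i a w : i <= size w -> nth x0 (insert i a w) i = a.
Proof. by move=> le_iw; rewrite nth_cat size_takel // ltnn subnn. Qed.

Lemma nth_insert_bump x0 i a w j :
  i <= size w -> nth x0 (insert i a w) (bump i j) = nth x0 w j.
Proof.
move=> le_iw; rewrite nth_cat size_takel // /bump; case: (leqP i j) => [le_ij|lt_ji].
  by rewrite add1n ltnNge leqW //= subSn //= nth_drop subnKC.
by rewrite add0n lt_ji nth_take.
Qed.

Lemma insert_size n a w : size w = n -> insert n a w = rcons w a.
Proof. by move=> <-; rewrite /insert take_size drop_size cats1. Qed.

Lemma insert_rcons i a w b :
  i <= size w -> insert i a (rcons w b) = rcons (insert i a w) b.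
Proof. by move=> le_iw; rewrite /insert drop_rcons // -cats1 takel_cat // rcons_cat. Qed.

Lemma insert_omit x0 i w : i < size w -> insert i (nth x0 w i) (omit i w) = w.
Proof.
move=> lt_iw; rewrite /insert /omit take_cat drop_cat size_takel ?ltnn ?subnn 1?ltnW //.
by rewrite take0 cats0 drop0 -drop_nth // cat_take_drop.
Qed.

Lemma nth_omit x0 i w j : nth x0 (omit i w) j = nth x0 w (bump i j).
Proof.
rewrite nth_cat /bump; have [le_wi|lt_iw] := leqP (size w) i.
  rewrite take_oversize // drop_oversize ?leqW //; case: ltnP => [lt_jw|le_wj].
    by rewrite leqNgt (leq_trans lt_jw).
  by rewrite nth_nil nth_default //; lia.
rewrite size_takel ?(ltnW lt_iw) //; case: (leqP i j) => [le_ij|lt_ji].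
  by rewrite nth_drop; congr nth; lia.
by rewrite nth_take.
Qed.

Lemma size_omit i w : i < size w -> size (omit i w) = (size w).-1.
Proof. move=> lt_iw; rewrite size_cat size_drop size_takel ?(ltnW lt_iw) //; lia. Qed.
End Insert.

Lemma perm_insert (T : eqType) i (a : T) w : perm_eq (insert i a w) (a :: w).
Proof. by rewrite /insert -cat1s perm_catCA cat1s cat_take_drop. Qed.

Lemma over_insert n q i a w : over n q w -> a < q -> over n.+1 q (insert i a w).
Proof.
move=> /andP[/eqP size_w lt_w] lt_a; rewrite /over size_insert size_w eqxx all_cat /= lt_a.
by rewrite -all_cat cat_take_drop.
Qed.

Lemma relabel_insert n s g i t a w : i <= n -> size s = n -> all (gtn n) s ->
  size g = n -> size w = n ->
  relabel (insert i n s) (insert i t g) (rcons w a) = insert i (ap t a) (relabel s g w).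
Proof.
move=> le_in size_s /all_nthP lt_s size_g size_w.
have size_r : size (relabel s g w) = n by rewrite size_map size_iota.
apply: (@eq_from_nth _ 0) => [|j]; first by rewrite size_map size_iota !size_insert size_r size_s.
rewrite size_map size_iota size_insert size_s => lt_j.
rewrite nth_relabel ?size_insert ?size_s //; have [->|ne_ij] := eqVneq j i.
  by rewrite !nth_insert ?size_s ?size_g ?size_r // nth_rcons size_w ltnn eqxx.
have <- : bump i (unbump i j) = j by apply: unbumpK; rewrite inE.
have lt_j' : unbump i j < n.
  by move: lt_j ne_ij; rewrite /unbump; lia.
rewrite !nth_insert_bump ?size_s ?size_g ?size_r // nth_relabel ?size_s // nth_rcons size_w.
by rewrite ifT //; apply: lt_s; rewrite size_s.
Qed.

Lemma relabel_rcons n q s g t w a : relabelling n q s g -> size w = n ->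
  relabel (rcons s n) (rcons g t) (rcons w a) = rcons (relabel s g w) (ap t a).
Proof.
move=> sg size_w; have [perm_s size_g _] := relabellingP _ _ _ _ sg.
have [size_s size_r] := (perm_table_size perm_s, size_relabel sg w).
have lt_s : all (gtn n) s by apply/allP => i; rewrite (mem_perm_table perm_s).
by rewrite -(insert_size _ size_s) -(insert_size _ size_g) -(insert_size _ size_r) relabel_insert.
Qed.

Lemma relabelling_insert n q s g i t : relabelling n q s g -> perm_table q t ->
  relabelling n.+1 q (insert i n s) (insert i t g).
Proof.
move=> /and3P[perm_s /eqP size_g perm_g] perm_t; apply/and3P; split.
- rewrite /perm_table -addn1 iotaD add0n cats1 (permPl (perm_insert i n s)).
  by rewrite perm_sym perm_rcons perm_cons perm_sym.
- by rewrite size_insert size_g.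
by rewrite all_cat /= perm_t -all_cat cat_take_drop.
Qed.

Lemma relabelling_rcons n q s g t : relabelling n q s g -> perm_table q t ->
  relabelling n.+1 q (rcons s n) (rcons g t).
Proof.
move=> sg perm_t; have [/perm_table_size size_s size_g _] := relabellingP _ _ _ _ sg.
by have := relabelling_insert n sg perm_t; rewrite !insert_size.
Qed.

(** * Sets of words meeting the Singleton bound *)

Definition positions (n k : nat) (I : seq nat) : bool := [&& uniq I, size I == k & all (gtn n) I].

Definition mds q n k (X : word -> Prop) : Prop :=
  [/\ forall w, X w -> over n q w,
      forall I w v, positions n k I -> X w -> X v -> {in I, forall i, ap w i = ap v i} -> w = v
    & forall I f, positions n k I -> (forall i, f i < q) ->
        exists2 w, X w & {in I, forall i, ap w i = f i}].

Definition pullback n q s g (X : word -> Prop) (w : word) : Prop :=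
  over n q w /\ X (relabel s g w).

Definition slice i a (X : word -> Prop) (w : word) : Prop := X (insert i a w).

Lemma mds_pullback q n k s g X :
  relabelling n q s g -> mds q n k X -> mds q n k (pullback n q s g X).
Proof.
move=> sg [overX injX exX]; have /relabellingP[perm_s size_g perm_g] := sg.
have size_s := perm_table_size perm_s.
pose image I := [seq index i s | i <- I].
have positions_image I : positions n k I -> positions n k (image I).
  case/and3P=> uniq_I size_I /allP lt_I; rewrite /positions size_map size_I all_map /=.
  rewrite map_inj_in_uniq ?uniq_I /= => [|i j /lt_I lt_i /lt_I lt_j eq_ij].
    by apply/allP => i /lt_I; apply: perm_table_index_lt.
  by rewrite -(perm_table_index perm_s lt_i) eq_ij (perm_table_index perm_s lt_j).
split=> [w []|I w v posI [ow Xw] [ov Xv] eq_wv|I f posI lt_f] //.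
  apply: (relabel_inj sg ow ov); apply: (injX _ _ _ (positions_image I posI) Xw Xv).
  move=> _ /mapP[i Ii ->]; have /and3P[_ _ /allP/(_ i Ii) lt_i] := posI.
  have lt_j := perm_table_index_lt perm_s lt_i.
  by rewrite !nth_relabel ?size_s // (perm_table_index perm_s lt_i) eq_wv.
have [i|u Xu eq_u] := exX _ (fun j => ap (tab g j) (f (ap s j))) (positions_image I posI).
  have [lt_i|le_i] := ltnP i n; first exact: (perm_table_lt (perm_g i lt_i)).
  by rewrite (nth_default _ (_ : size g <= i)) ?size_g // nth_nil (leq_ltn_trans _ (lt_f 0)).
have [w ow eq_w] := relabel_surj sg (overX u Xu).
exists w => [|i Ii]; first by split; rewrite ?eq_w.
have /and3P[_ _ /allP/(_ i Ii) lt_i] := posI; have lt_j := perm_table_index_lt perm_s lt_i.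
rewrite -[in LHS](perm_table_index perm_s lt_i) -(index_relabel sg ow lt_j) eq_w.
by rewrite (eq_u _ (map_f _ Ii)) (perm_table_indexK (perm_g _ lt_j)) (perm_table_index perm_s lt_i).
Qed.

Lemma mds_slice q n k i a X :
  i <= n -> a < q -> mds q n.+1 k.+1 X -> mds q n k (slice i a X).
Proof.
move=> le_in lt_a [overX injX exX].
have size_slice w : slice i a X w -> size w = n.
  by case/overX/andP; rewrite size_insert eqSS => /eqP.
have lt_bump j : j < n -> bump i j < n.+1 by rewrite /bump; lia.
have positions_lift I : positions n k I -> positions n.+1 k.+1 (i :: map (bump i) I).
  case/and3P=> uniq_I /eqP size_I /allP lt_I; apply/and3P; split=> /=.
  - rewrite (map_inj_uniq (can_inj (@bumpK i))) uniq_I andbT.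
    by apply/mapP => -[j _ eq_i]; have := neq_bump i j; rewrite -eq_i eqxx.
  - by rewrite size_map size_I.
  by rewrite ltnS le_in all_map; apply/allP => j /lt_I; apply: lt_bump.
split=> [w Xw|I w v posI Xw Xv eq_wv|I f posI lt_f].
- apply/overP; split=> [|j lt_j]; first exact: size_slice.
  have [_ lt_w] := overP _ _ _ (overX _ Xw).
  by rewrite -(nth_insert_bump 0 a j (_ : i <= size w)) ?size_slice // lt_w ?lt_bump.
- have: insert i a w = insert i a v.
    apply: (injX _ _ _ (positions_lift I posI)) => // _ /predU1P[->|/mapP[j Ij ->]].
      by rewrite !nth_insert ?size_slice.
    by rewrite !nth_insert_bump ?size_slice // eq_wv.
  move=> eq_ins; apply: (@eq_from_nth _ 0) => [|j _]; first by rewrite !size_slice.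
  rewrite -(nth_insert_bump 0 a j (_ : i <= size w)) ?size_slice // eq_ins.
  by rewrite nth_insert_bump ?size_slice.
have [j|u Xu eq_u] := exX _ (fun j => if j == i then a else f (unbump i j)) (positions_lift I posI).
  by case: eqP.
have [size_u _] := overP _ _ _ (overX u Xu).
have eq_ins : insert i a (omit i u) = u.
  rewrite -[RHS](insert_omit 0 (_ : i < size u)) ?size_u //.
  by rewrite eq_u ?eqxx // mem_head.
exists (omit i u) => [|j Ij]; first by rewrite /slice eq_ins.
rewrite -(nth_insert_bump 0 a j (_ : i <= size (omit i u))) ?size_omit ?size_u //.
by rewrite eq_ins eq_u ?in_cons ?map_f ?orbT // eq_sym (negbTE (neq_bump i j)) bumpK.
Qed.

(** * Planes and their lines *)

(* A line is a list of triples.  Line [j] of a plane consists of the first three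
   entries of the words that end in [j]. *)
Notation line := (seq (seq nat)) (only parsing).
Notation plane := (seq (seq (seq nat))) (only parsing).

Definition plane_words (L : plane) : seq word :=
  [seq rcons p j | j <- iota 0 (size L), p <- nth [::] L j].

Lemma mem_plane_words L p j :
  (rcons p j \in plane_words L) = (j < size L) && (p \in nth [::] L j).
Proof.
apply/allpairsPdep/andP => [[j' [p' [+ + /rcons_inj[-> ->]]]]|[lt_j Lp]].
  by rewrite mem_iota0.
by exists j, p; rewrite mem_iota0.
Qed.

Definition graph q (B C : table) : line := [seq [:: a; ap B a; ap C a] | a <- iota 0 q].

Definition diagonal q : line := graph q (iota 0 q) (iota 0 q).

Lemma mem_graph q B C a : a < q -> [:: a; ap B a; ap C a] \in graph q B C.
Proof. by move=> lt_a; apply/mapP; exists a; rewrite ?mem_iota0. Qed.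

Definition contains_line (P : word -> Prop) (l : line) e : Prop := {in l, forall p, P (rcons p e)}.

Lemma contains_graphP P q B C e : contains_line P (graph q B C) e <->
  (forall a, a < q -> P [:: a; ap B a; ap C a; e]).
Proof.
split=> [Pl a lt_a|Pl _ /mapP[a + ->]]; first exact: Pl (mem_graph B C lt_a).
by rewrite mem_iota0; apply: Pl.
Qed.

Lemma contains_diagonalP P q e :
  contains_line P (diagonal q) e <-> (forall a, a < q -> P [:: a; a; a; e]).
Proof.
by rewrite contains_graphP; split=> Pl a lt_a; have := Pl a lt_a; rewrite nth_iota0.
Qed.

Definition contains_lines (P : word -> Prop) (L : plane) (d : table) : Prop :=
  forall p j, rcons p j \in plane_words L -> P (rcons p (ap d j)).

Lemma bounded_choice (T : Type) (x0 : T) n (R : nat -> T -> Prop) :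
  (forall i, i < n -> exists x, R i x) -> exists f, forall i, i < n -> R i (f i).
Proof.
move=> exR; have [f fR] := fin_all_exists (fun i : 'I_n => exR i (ltn_ord i)).
exists (fun i => oapp f x0 (insub i)) => i lt_in.
by rewrite (insubT (fun i => i < n) lt_in) /=; apply: fR (Ordinal lt_in).
Qed.

Lemma mds_agree q n k X I w v : mds q n k X -> positions n k I -> X w -> X v ->
  all (fun i => ap w i == ap v i) I -> w = v.
Proof.
case=> _ injX _ posI Xw Xv /allP eq_wv; apply: (injX I) => // i Ii.
exact/eqP/eq_wv.
Qed.

Section Plane.
Variables (q : nat) (P : word -> Prop).
Hypothesis mdsP : mds q 4 2 P.

Lemma plane_over w : P w -> over 4 q w. Proof. by case: mdsP => overP _ _; apply: overP. Qed.

Lemma plane_inj i j w v : positions 4 2 [:: i; j] -> P w -> P v ->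
  ap w i = ap v i -> ap w j = ap v j -> w = v.
Proof.
by move=> pos_ij Pw Pv eq_i eq_j; apply: (mds_agree mdsP pos_ij) => //=; rewrite eq_i eq_j !eqxx.
Qed.

Lemma plane_word i j : positions 4 2 [:: i; j] -> exists F : nat -> nat -> word,
  forall a b, a < q -> b < q -> [/\ P (F a b), ap (F a b) i = a & ap (F a b) j = b].
Proof.
move=> pos_ij; pose R a b w := [/\ P w, ap w i = a & ap w j = b].
have [|F FP] := @bounded_choice _ (fun=> [::]) q (fun a f => forall b, b < q -> R a b (f b)).
  move=> a lt_a; apply: (bounded_choice [::]) => b lt_b.
  have [_ _ exP] := mdsP; have [l|w Pw eq_w] := exP _ (fun l => if l == i then a else b) pos_ij.
    by case: ifP.
  have /and3P[/= /andP[]] := pos_ij; rewrite inE => ne_ij _ _ _; exists w.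
  by split; rewrite // eq_w ?inE ?eqxx ?orbT // eq_sym (negbTE ne_ij).
by exists F => a b lt_a lt_b; apply: FP.
Qed.

Lemma plane_triple w : P w -> w = [:: ap w 0; ap w 1; ap w 2; ap w 3].
Proof. by case/plane_over/overP; case: w => [|? [|? [|? [|? []]]]]. Qed.

Lemma plane_lt w i : P w -> i < 4 -> ap w i < q.
Proof. by case/plane_over/overP=> _; apply. Qed.

Lemma perm_line_tables B C e : size B = q -> size C = q ->
  contains_line P (graph q B C) e -> perm_table q B /\ perm_table q C.
Proof.
move=> size_B size_C /contains_graphP Pl.
split; apply: perm_tableI => // [a lt_a|a b lt_a lt_b eq_ab].
- exact: (plane_lt (i := 1) (Pl a lt_a)).
- by have [] := plane_inj (isT : positions 4 2 [:: 1; 3]) (Pl a lt_a) (Pl b lt_b) eq_ab erefl.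
- exact: (plane_lt (i := 2) (Pl a lt_a)).
by have [] := plane_inj (isT : positions 4 2 [:: 2; 3]) (Pl a lt_a) (Pl b lt_b) eq_ab erefl.
Qed.

Lemma plane_line e : e < q -> exists B C,
  [/\ perm_table q B, perm_table q C & contains_line P (graph q B C) e].
Proof.
move=> lt_e; have [F FP] := plane_word (isT : positions 4 2 [:: 0; 3]).
pose col i := [seq ap (F a e) i | a <- iota 0 q].
have Pl : contains_line P (graph q (col 1) (col 2)) e.
  apply/contains_graphP => a lt_a; have [Pw w0 w3] := FP a e lt_a lt_e.
  by rewrite !nth_map_iota //; have := plane_triple Pw; rewrite w0 w3 => <-.
have size_col i : size (col i) = q by rewrite size_map size_iota.
by have [] := perm_line_tables (size_col 1) (size_col 2) Pl; exists (col 1), (col 2).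
Qed.
End Plane.

Lemma over_graph q B C : perm_table q B -> perm_table q C -> all (over 3 q) (graph q B C).
Proof.
move=> perm_B perm_C; apply/allP => _ /mapP[a + ->]; rewrite mem_iota0 => lt_a.
by rewrite /over /= lt_a !perm_table_lt.
Qed.

(** * Completing two lines to a plane *)

(* All ways to choose one element of each list so that the choices are pairwise
   compatible. *)
Fixpoint select (T : Type) (compat : rel T) n (choices : seq (seq T)) : seq (seq T) :=
  if n is n'.+1 then
    if choices is xs :: rest then
      flatten [seq [seq x :: s | s <- select compat n' [seq filter (compat x) ys | ys <- rest]]
              | x <- xs]
    else [:: [::]]
  else [:: [::]].

Definition selections (T : Type) (compat : rel T) choices :=
  select compat (size choices) choices.

Lemma mem_selections (S T : eqType) (compat : rel T) (f : S -> T) (choices : S -> seq T) r :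
  uniq r ->
  {in r, forall i, f i \in choices i} ->
  {in r &, forall i j, i != j -> compat (f i) (f j)} ->
  map f r \in selections compat (map choices r).
Proof.
rewrite /selections size_map.
elim: r choices => [|i r IHr] choices //= /andP[r'i uniq_r] choiceP compatP.
apply/flattenP; eexists; first by apply: map_f; apply: choiceP (mem_head _ _).
apply: map_f; rewrite -map_comp; apply: IHr => // [j rj|j k rj rk] /=.
  rewrite mem_filter compatP ?mem_head ?choiceP ?in_cons ?rj ?orbT //.
  by apply: contraNneq r'i => ->.
by apply: compatP; rewrite in_cons ?rj ?rk orbT.
Qed.

Definition discordant : rel table := all2 (fun x y => x != y).

Lemma discordant_map (S : eqType) (f g : S -> nat) r :
  {in r, forall i, f i != g i} -> discordant (map f r) (map g r).
Proof.
elim: r => //= i r IHr ne_fg; rewrite ne_fg ?mem_head // IHr // => j rj.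
by apply: ne_fg; rewrite in_cons rj orbT.
Qed.

Section Completions.
Variable q : nat.
Notation idx := (iota 0 q).

(* Symbols [c] that a plane through the diagonal and [graph q pi sg] may have in a
   word [(a, b, c, e)]. *)
Definition row_domain (pi sg : table) (a b : nat) : seq nat :=
  [seq c <- idx | if b == a then c == a else if b == ap pi a then c == ap sg a
                  else (c != b) && (c != ap sg (index b pi))].

Definition latin_rows pi sg a : seq table :=
  selections (fun c c' => c != c') [seq row_domain pi sg a b | b <- idx].

Definition latin_squares pi sg : seq (seq table) :=
  selections discordant [seq latin_rows pi sg a | a <- idx].

Definition free_pairs (pi : table) (rows : seq table) a : seq (nat * nat) :=
  [seq p <- zip idx (tab rows a) | (p.1 != a) && (p.1 != ap pi a)].

Definition transversals (choices : seq (seq (nat * nat))) : seq (seq (nat * nat)) :=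
  selections (fun p p' => (p.1 != p'.1) && (p.2 != p'.2)) choices.

Definition resolutions (pairs : nat -> seq (nat * nat)) : seq (seq (seq (nat * nat))) :=
  let later := map pairs (behead idx) in
  selections (fun t t' => discordant (unzip1 t) (unzip1 t'))
    [seq transversals ([:: p] :: later) | p <- pairs 0].

Definition line_of_pairs (t : seq (nat * nat)) : line := graph q (unzip1 t) (unzip2 t).

(* Fills in the third symbol of each word, as a Latin square, and then resolves the
   square into lines. *)
Definition completions (pi sg : table) : seq plane :=
  [seq [:: diagonal q, graph q pi sg & map line_of_pairs ts]
  | rows <- latin_squares pi sg, ts <- resolutions (free_pairs pi rows)].

Section Complete.
Variables (P : word -> Prop) (pi sg : table) (e0 e1 : nat).
Hypotheses (mdsP : mds q 4 2 P) (perm_pi : perm_table q pi).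
Hypotheses (lt_e0 : e0 < q) (lt_e1 : e1 < q) (ne_e01 : e0 != e1).
Hypotheses (Pl0 : contains_line P (diagonal q) e0) (Pl1 : contains_line P (graph q pi sg) e1).

Variables cell point : nat -> nat -> word.
Hypothesis cellP : forall a b, a < q -> b < q ->
  [/\ P (cell a b), ap (cell a b) 0 = a & ap (cell a b) 1 = b].
Hypothesis pointP : forall a e, a < q -> e < q ->
  [/\ P (point a e), ap (point a e) 0 = a & ap (point a e) 3 = e].

Let row a : table := [seq ap (cell a b) 2 | b <- idx].
Let pairs := free_pairs pi [seq row a | a <- idx].
Let line_at e := [seq (ap (point a e) 1, ap (point a e) 2) | a <- idx].
Let parallel (p : nat * nat) := ap (cell 0 p.1) 3.

Let P_e0 a : a < q -> P [:: a; a; a; e0]. Proof. exact: (contains_diagonalP _ _ _).1. Qed.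
Let P_e1 a : a < q -> P [:: a; ap pi a; ap sg a; e1].
Proof. exact: (contains_graphP _ _ _ _ _).1. Qed.
Let gt0_q : 0 < q := leq_ltn_trans (leq0n _) lt_e0.

Lemma cell_diagonal a : a < q -> cell a a = [:: a; a; a; e0].
Proof.
move=> lt_a; have [Pw w0 w1] := cellP lt_a lt_a.
exact: (plane_inj mdsP (isT : positions 4 2 [:: 0; 1]) Pw (P_e0 lt_a)).
Qed.

Lemma cell_graph a : a < q -> cell a (ap pi a) = [:: a; ap pi a; ap sg a; e1].
Proof.
move=> lt_a; have [Pw w0 w1] := cellP lt_a (perm_table_lt perm_pi lt_a).
exact: (plane_inj mdsP (isT : positions 4 2 [:: 0; 1]) Pw (P_e1 lt_a)).
Qed.

Lemma row_in_domain a b : a < q -> b < q -> ap (cell a b) 2 \in row_domain pi sg a b.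
Proof.
move=> lt_a lt_b; have [Pw w0 w1] := cellP lt_a lt_b.
rewrite mem_filter mem_iota0 (plane_lt mdsP) // andbT.
case: eqP => [->|ne_ba]; first by rewrite cell_diagonal.
case: eqP => [->|ne_bpi]; first by rewrite cell_graph.
have inj12 := plane_inj mdsP (isT : positions 4 2 [:: 1; 2]) Pw.
apply/andP; split; apply/eqP => w2.
  by apply: ne_ba; rewrite -w0 (inj12 _ (P_e0 lt_b)).
have lt_x := perm_table_index_lt perm_pi lt_b.
have := inj12 _ (P_e1 lt_x); rewrite /= w1 (perm_table_index perm_pi lt_b) => /(_ erefl w2) eq_w.
by apply: ne_bpi; rewrite -w0 eq_w /= (perm_table_index perm_pi lt_b).
Qed.

Lemma mem_latin_squares : [seq row a | a <- idx] \in latin_squares pi sg.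
Proof.
apply: mem_selections => [|a|a a']; rewrite ?iota_uniq ?mem_iota0 //= => lt_a.
  apply: mem_selections => [|b|b b']; rewrite ?iota_uniq ?mem_iota0 //= => lt_b.
    exact: row_in_domain.
  move=> lt_b'; apply: contraNneq => eq_c.
  have [[Pw w0 w1] [Pv v0 v1]] := (cellP lt_a lt_b, cellP lt_a lt_b').
  by apply/eqP; rewrite -w1 (plane_inj mdsP (isT : positions 4 2 [:: 0; 2]) Pw Pv) ?w0 ?v0.
move=> lt_a' ne_a; apply: discordant_map => b; rewrite mem_iota0 => lt_b.
apply: contraNneq ne_a => eq_c.
have [[Pw w0 w1] [Pv v0 v1]] := (cellP lt_a lt_b, cellP lt_a' lt_b).
by apply/eqP; rewrite -w0 (plane_inj mdsP (isT : positions 4 2 [:: 1; 2]) Pw Pv) ?w1 ?v1.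
Qed.

Lemma mem_free_pairs a p : a < q -> reflect
  (exists b, [/\ b < q, p = (b, ap (cell a b) 2), b != a & b != ap pi a]) (p \in pairs a).
Proof.
move=> lt_a; rewrite /pairs /free_pairs nth_map_iota // mem_filter.
have -> : zip idx (row a) = [seq (b, ap (cell a b) 2) | b <- idx].
  by rewrite -[X in zip X]map_id zip_map.
apply: (iffP andP) => [[ne_b /mapP[b]]|[b [lt_b -> ne_ba ne_bpi]]].
  by rewrite mem_iota0 => lt_b def_p; move: ne_b; rewrite def_p => /andP[]; exists b.
by rewrite ne_ba; split=> //; apply/mapP; exists b; rewrite ?mem_iota0.
Qed.

Lemma parallelP p : p \in pairs 0 ->
  [/\ parallel p < q, parallel p != e0, parallel p != e1
    & p = (ap (point 0 (parallel p)) 1, ap (point 0 (parallel p)) 2)].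
Proof.
case/(mem_free_pairs _ gt0_q)=> b [lt_b -> ne_b0 ne_bpi]; rewrite /parallel /=.
have [Pw w0 w1] := cellP gt0_q lt_b; set e := ap _ 3.
have lt_e : e < q by apply: (plane_lt mdsP Pw).
have inj03 := plane_inj mdsP (isT : positions 4 2 [:: 0; 3]) Pw.
have [Pv v0 v3] := pointP gt0_q lt_e.
split=> //; last by rewrite -(inj03 _ Pv) ?w1 ?v0 ?v3.
  by apply: contraNneq ne_b0 => eq_e; rewrite -w1 (inj03 _ (P_e0 gt0_q)).
by apply: contraNneq ne_bpi => eq_e; rewrite -w1 (inj03 _ (P_e1 gt0_q)).
Qed.

Lemma point_free a e : a < q -> e < q -> e != e0 -> e != e1 ->
  (ap (point a e) 1, ap (point a e) 2) \in pairs a.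
Proof.
move=> lt_a lt_e ne_e0 ne_e1; have [Pw w0 w3] := pointP lt_a lt_e.
have lt_b : ap (point a e) 1 < q by apply: (plane_lt mdsP Pw).
have inj01 := plane_inj mdsP (isT : positions 4 2 [:: 0; 1]) Pw.
apply/mem_free_pairs => //; exists (ap (point a e) 1); split=> //.
- have [Pv v0 v1] := cellP lt_a lt_b.
  by rewrite (inj01 _ Pv) ?w0 ?v0 ?v1.
- by apply: contraNneq ne_e0 => eq_b; rewrite -w3 (inj01 _ (P_e0 lt_a)).
by apply: contraNneq ne_e1 => eq_b; rewrite -w3 (inj01 _ (P_e1 lt_a)).
Qed.

Lemma line_transversal p : p \in pairs 0 ->
  line_at (parallel p) \in transversals ([:: p] :: map pairs (behead idx)).
Proof.
have -> : [:: p] :: map pairs (behead idx) = [seq if a == 0 then [:: p] else pairs a | a <- idx].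
  have -> : idx = 0 :: behead idx by case: (q) gt0_q.
  congr cons; apply/eq_in_map => -[|a] //; rewrite -(prednK gt0_q) /= mem_iota.
  by rewrite ltnn.
case/parallelP; set e := parallel p => lt_e ne_e0 ne_e1 def_p.
apply: mem_selections => [|a|a a']; rewrite ?iota_uniq ?mem_iota0 //= => lt_a.
  by case: eqP => [->|_]; [rewrite -def_p mem_head | apply: point_free].
move=> lt_a' ne_a; have [[Pw w0 w3] [Pv v0 v3]] := (pointP lt_a lt_e, pointP lt_a' lt_e).
apply/andP; split; apply: contraNneq ne_a => eq_b; apply/eqP; rewrite -w0.
  by rewrite (plane_inj mdsP (isT : positions 4 2 [:: 1; 3]) Pw Pv) ?w3 ?v3.
by rewrite (plane_inj mdsP (isT : positions 4 2 [:: 2; 3]) Pw Pv) ?w3 ?v3.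
Qed.

Lemma parallel_inj : {in pairs 0 &, injective parallel}.
Proof.
move=> p p' /parallelP[_ _ _ def_p] /parallelP[_ _ _ def_p'] eq_e.
by rewrite def_p eq_e -def_p'.
Qed.

Lemma uniq_free_pairs : uniq (pairs 0).
Proof.
rewrite filter_uniq // (@map_uniq _ _ fst) // -/unzip1 unzip1_zip ?iota_uniq //.
by rewrite nth_map_iota // size_map.
Qed.

Lemma mem_resolutions : [seq line_at (parallel p) | p <- pairs 0] \in resolutions pairs.
Proof.
apply: mem_selections => [|p|p p' p_in p'_in ne_p]; first exact: uniq_free_pairs.
  exact: line_transversal.
rewrite /line_at /unzip1 -!map_comp; apply: discordant_map => a /=; rewrite mem_iota0 => lt_a.
have [[lt_e _ _ _] [lt_e' _ _ _]] := (parallelP p_in, parallelP p'_in).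
have [[Pw w0 w3] [Pv v0 v3]] := (pointP lt_a lt_e, pointP lt_a lt_e').
apply: contraNneq ne_p => eq_b; apply/eqP/parallel_inj => //.
by rewrite -w3 (plane_inj mdsP (isT : positions 4 2 [:: 0; 1]) Pw Pv) ?w0 ?v0.
Qed.

Lemma perm_line_ends : perm_table q (e0 :: e1 :: map parallel (pairs 0)).
Proof.
apply: uniq_perm => [||e]; rewrite ?iota_uniq //=.
  rewrite inE negb_or ne_e01 (map_inj_in_uniq parallel_inj) uniq_free_pairs andbT /=.
  by apply/andP; split; apply/mapP => -[p /parallelP[_ ne_e0 ne_e1 _] eq_e];
    rewrite eq_e eqxx in ne_e0 ne_e1.
rewrite !inE mem_iota0; apply/idP/idP => [/or3P[/eqP->|/eqP->|/mapP[p /parallelP[? _ _ _] ->]] //|].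
move=> lt_e; case: eqP => //= /eqP ne_e0; case: eqP => //= /eqP ne_e1.
have [Pw w0 w3] := pointP gt0_q lt_e.
have lt_b : ap (point 0 e) 1 < q by apply: (plane_lt mdsP Pw).
apply/mapP; eexists; first exact: (point_free gt0_q lt_e).
have [Pv v0 v1] := cellP gt0_q lt_b.
by rewrite /parallel /= (plane_inj mdsP (isT : positions 4 2 [:: 0; 1]) Pv Pw) ?v0.
Qed.

Lemma mem_line_of_pairs e p : e < q -> p \in line_of_pairs (line_at e) -> P (rcons p e).
Proof.
move=> lt_e /mapP[a]; rewrite mem_iota0 => lt_a ->; have [Pw w0 w3] := pointP lt_a lt_e.
rewrite /line_at /unzip1 /unzip2 -!map_comp !nth_map_iota //=.
by have := plane_triple mdsP Pw; rewrite w0 w3 => <-.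
Qed.

Lemma completion_lines : exists2 L, L \in completions pi sg &
  exists es, [/\ perm_table q es, ap es 0 = e0 & contains_lines P L es].
Proof.
exists [:: diagonal q, graph q pi sg & map line_of_pairs [seq line_at (parallel p) | p <- pairs 0]].
  apply/allpairsPdep; exists [seq row a | a <- idx], [seq line_at (parallel p) | p <- pairs 0].
  by split; [apply: mem_latin_squares | apply: mem_resolutions |].
exists (e0 :: e1 :: map parallel (pairs 0)); split=> //; first exact: perm_line_ends.
move=> p [|[|j]]; rewrite mem_plane_words => /andP[/= lt_j].
- exact: Pl0.
- exact: Pl1.
move: lt_j; rewrite !ltnS size_map size_map => lt_j.
rewrite (nth_map [::]) ?size_map // !(nth_map (0, 0)) // => p_in.
by apply: mem_line_of_pairs p_in; have [] := parallelP (mem_nth (0, 0) lt_j).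
Qed.
End Complete.

Lemma completion_exists P pi sg e0 e1 : mds q 4 2 P -> perm_table q pi ->
  e0 < q -> e1 < q -> e0 != e1 ->
  contains_line P (diagonal q) e0 -> contains_line P (graph q pi sg) e1 ->
  exists2 L, L \in completions pi sg &
    exists es, [/\ perm_table q es, ap es 0 = e0 & contains_lines P L es].
Proof.
move=> mdsP perm_pi lt_e0 lt_e1 ne_e01 Pl0 Pl1.
have [cell cellP] := plane_word mdsP (isT : positions 4 2 [:: 0; 1]).
have [point pointP] := plane_word mdsP (isT : positions 4 2 [:: 0; 3]).
exact: (completion_lines mdsP perm_pi lt_e0 lt_e1 ne_e01 Pl0 Pl1 cellP pointP).
Qed.
End Completions.

(** * Normal forms of planes *)

Definition column i (ps : seq word) : table := [seq ap p i | p <- ps].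

Definition is_line q (l : line) : bool :=
  all (over 3 q) l && all (fun i => perm_table q (column i l)) (iota 0 3).

Definition normal_form q (L : plane) : bool :=
  [&& size L == q, all (is_line q) L & nth [::] L 0 == diagonal q].

Definition embeds s g (L L' : plane) : bool :=
  all (fun w => relabel s g w \in plane_words L') (plane_words L).

(* A frame parametrizes a line. *)
Definition frame q (m : seq table) : bool := (size m == 3) && all (perm_table q) m.

Definition frame_line q (m : seq table) : line := [seq [seq ap t a | t <- m] | a <- iota 0 q].

Definition comp_frame (m : seq table) (tau : table) : seq table := [seq comp_table t tau | t <- m].

(* The coordinates of [L] are permuted by [s] and its symbols renamed by [tau], which
   preserves the diagonal, and the diagonal is moved to the line of [m]; the line
   [j] ends up as line [d j] of [P]. *)
Definition realizes q (P : word -> Prop) (L : plane) s tau m d : Prop :=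
  [/\ perm_table 3 s, perm_table q tau, perm_table q d &
      forall p j, rcons p j \in plane_words L ->
        P (rcons (relabel s (comp_frame m tau) p) (ap d j))].

Definition normal_at q (phis : seq plane) P m e : Prop :=
  exists i s tau d,
    [/\ i < size phis, realizes q P (nth [::] phis i) s tau m d & ap d 0 = e].

Section NormalForm.
Variables (q : nat) (L : plane).
Hypothesis form_L : normal_form q L.

Lemma normal_form_size : size L = q. Proof. by case/and3P: form_L => /eqP. Qed.

Lemma normal_form_line j : j < q -> is_line q (nth [::] L j).
Proof. by case/and3P: form_L => /eqP <- /allP line_L _ lt_j; apply/line_L/mem_nth. Qed.

Lemma normal_form_word p j : rcons p j \in plane_words L -> over 3 q p /\ j < q.
Proof.
rewrite mem_plane_words normal_form_size => /andP[lt_j p_in]; split=> //.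
by have /andP[/allP over_l _] := normal_form_line lt_j; apply: over_l.
Qed.

Lemma normal_form_point i x j : i < 3 -> x < q -> j < q ->
  exists2 p, rcons p j \in plane_words L & ap p i = x.
Proof.
move=> lt_i lt_x lt_j; set l := nth [::] L j.
have perm_col : perm_table q (column i l).
  by have /andP[_ /allP] := normal_form_line lt_j; apply; rewrite mem_iota0.
have lt_k : index x (column i l) < size l.
  by rewrite -(size_map (fun p => ap p i)) index_mem (mem_perm_table perm_col).
exists (tab l (index x (column i l))).
  by rewrite mem_plane_words normal_form_size lt_j mem_nth.
by rewrite -[RHS](perm_table_index perm_col lt_x) (nth_map [::]).
Qed.
End NormalForm.

Definition classifies q (phis : seq plane) : Prop := forall P m e, mds q 4 2 P -> e < q ->
  frame q m -> contains_line P (frame_line q m) e -> normal_at q phis P m e.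

Section Frames.
Variable q : nat.

Lemma frameP m : frame q m -> size m = 3 /\ forall i, i < 3 -> perm_table q (tab m i).
Proof. by case/andP=> /eqP <- /(all_nthP [::]). Qed.

Lemma frame_nseq t : perm_table q t -> frame q (nseq 3 t).
Proof. by move=> perm_t; rewrite /frame /= perm_t. Qed.

Lemma nth_comp_frame m tau i x : i < size m -> x < size tau ->
  ap (tab (comp_frame m tau) i) x = ap (tab m i) (ap tau x).
Proof. by move=> lt_i lt_x; rewrite (nth_map [::]) // nth_comp_table. Qed.

Lemma relabelling_frame s m tau : perm_table 3 s -> perm_table q tau -> frame q m ->
  relabelling 3 q s (comp_frame m tau).
Proof.
move=> perm_s perm_tau /frameP[size_m perm_m]; apply/relabellingP.
rewrite size_map; split=> // i lt_i.
by rewrite (nth_map [::]) ?size_m // perm_comp_table ?perm_m.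
Qed.
End Frames.

Section LineChange.
Variables (q : nat) (P : word -> Prop) (s : seq nat) (g : seq table).
Hypotheses (mdsP : mds q 4 2 P) (sg : relabelling 3 q s g).

Definition relabel_lines : word -> Prop := pullback 4 q (rcons s 3) (rcons g (iota 0 q)) P.

Lemma mds_relabel_lines : mds q 4 2 relabel_lines.
Proof. exact: mds_pullback (relabelling_rcons sg (perm_table_iota q)) mdsP. Qed.

Lemma relabel_linesE p e : over 3 q p -> e < q ->
  relabel_lines (rcons p e) <-> P (rcons (relabel s g p) e).
Proof.
move=> over_p lt_e; have [/eqP size_p _] := andP over_p.
rewrite /relabel_lines /pullback (relabel_rcons _ _ sg) // nth_iota0 //.
split=> [[]|] //; split=> //.
by rewrite -(insert_size _ size_p) over_insert.
Qed.
End LineChange.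

Lemma normal_at_relabel q phis P s0 g m m' K e : all (normal_form q) phis ->
  relabelling 3 q s0 g -> frame q m -> frame q m' -> perm_table q K ->
  (forall i x, i < 3 -> x < q ->
     ap (tab g i) (ap (tab m' (ap s0 i)) x) = ap (tab m i) (ap K x)) ->
  normal_at q phis (relabel_lines q P s0 g) m' e -> normal_at q phis P m e.
Proof.
move=> /all_nthP forms s0g frame_m frame_m' perm_K eq_mK.
case=> i [s [tau [d [lt_i [perm_s perm_tau perm_d real] d0]]]].
have [perm_s0 _ _] := relabellingP _ _ _ _ s0g.
exists i, (comp_table s s0), (comp_table K tau), d; split=> //.
split=> [|||p j L_p]; rewrite ?perm_comp_table //.
have [over_p lt_j] := normal_form_word (forms [::] i lt_i) L_p.
have := real p j L_p; rewrite relabel_linesE ?(perm_table_lt perm_d) //; last first.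
  exact: over_relabel (relabelling_frame perm_s perm_tau frame_m') _ over_p.
have [[size_m _] [size_m' _]] := (frameP frame_m, frameP frame_m').
have size_tau := perm_table_size perm_tau.
rewrite (relabel_comp (n := 3) (q := q) (h := comp_frame m (comp_table K tau))) // => k x lt_k lt_x.
have lt_tau := perm_table_lt perm_tau lt_x.
rewrite !nth_comp_frame ?size_map ?size_m ?size_m' ?size_tau ?perm_table_lt //.
by rewrite nth_comp_table ?size_tau // eq_mK.
Qed.

(** * Reduction to finitely many pairs of lines *)

(* An index of a normal form, a permutation of the coordinates and a renaming of
   the symbols. *)
Definition certificate : Type := nat * seq nat * table.

(* For permutations [pi], one for each cycle type, a list of permutations [sg] and,
   for every plane through the diagonal and [graph pi sg], its certificate. *)
Definition rectangles : Type := seq (table * seq (table * seq certificate)).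

Definition line_images s tau (L L' : plane) : seq nat :=
  [seq find (fun l' => relabel s (nseq 3 tau) (head [::] l) \in l') L' | l <- L].

Section Rectangles.
Variables (q : nat) (phis : seq plane) (rs : rectangles).
Notation idx := (iota 0 q).

Definition certifies (L : plane) (c : certificate) : bool :=
  let: (i, s, tau) := c in
  let d := line_images s tau (nth [::] phis i) L in
  [&& i < size phis, perm_table 3 s, perm_table q tau, perm_table q d, ap d 0 == 0
    & embeds (rcons s 3) (rcons (nseq 3 tau) d) (nth [::] phis i) L].

Definition rectangles_certified : bool :=
  all (fun r => all (fun e => all2 certifies (completions q r.1 e.1) e.2) r.2) rs.

Definition sends s h (l l' : line) : bool :=
  all (fun p => relabel s (nseq 3 h) p \in l') l.

Definition derangements : seq table :=
  [seq t <- permutations idx | discordant idx t].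

Definition discordants (pi : table) : seq table := [seq t <- derangements | discordant pi t].

Definition centralizer (pi : table) : seq table :=
  [seq t <- permutations idx | comp_table t pi == comp_table pi t].

Definition quotient (B A : table) : table := [seq ap B (index a A) | a <- idx].

(* The cycles of [x], shortest first, written one after the other. *)
Definition cycle_listing (x : table) : table :=
  undup (flatten (sort (fun u v => size u <= size v) [seq undup (traject (ap x) a q) | a <- idx])).

Definition conjugate_to_listed (pi : table) : bool :=
  let h := cycle_listing pi in
  perm_table q h && has (fun r => comp_table pi h == comp_table h r.1) rs.

(* Only the test in the innermost [if] matters for soundness: the rest finds the
   renaming [k].  It is not a conjunction because the virtual machine would evaluate
   both of its members. *)
Definition reducible (cents : seq (seq table)) (pi sg : table) : bool :=
  has (fun s =>
    let A i := tab [:: idx; pi; sg] (index i s) in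
    let x := quotient (A 1) (A 0) in
    let z := quotient (A 2) (A 0) in
    let h := cycle_listing x in
    let t := find (fun r => comp_table x h == comp_table h r.1) rs in
    let r := nth ([::], [::]) rs t in
    has (fun c =>
      let k := comp_table h c in
      let sg' := [seq index (ap z a) k | a <- k] in
      has (fun e => if e.1 == sg' then
          perm_table q k && sends s k (graph q r.1 e.1) (graph q pi sg) else false) r.2)
    (tab cents t))
  (permutations (iota 0 3)).

Definition rectangles_cover : bool :=
  let cents := [seq centralizer r.1 | r <- rs] in
  all conjugate_to_listed derangements
  && all (fun r => all (reducible cents r.1) (discordants r.1)) rs.

Definition rectangles_wf : bool :=
  all (fun r => perm_table q r.1 && all (fun e => perm_table q e.1) r.2) rs.
End Rectangles.

Lemma discordantI q s t : size s = q -> size t = q ->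
  (forall a, a < q -> ap s a != ap t a) -> discordant s t.
Proof.
move=> size_s size_t ne_st; rewrite -(mkseq_nth 0 s) -(mkseq_nth 0 t) size_s size_t.
by apply: discordant_map => a; rewrite mem_iota0; apply: ne_st.
Qed.

Section Classification.
Variables (q : nat) (phis : seq plane) (rs : rectangles).
Hypotheses (gt1_q : 1 < q) (forms : all (normal_form q) phis).
Hypotheses (wf : rectangles_wf q rs) (certified : rectangles_certified q phis rs).
Hypothesis cover : rectangles_cover q rs.
Notation idx := (iota 0 q).
Notation id_frame := (nseq 3 idx).

Let frame_id : frame q id_frame := frame_nseq (perm_table_iota q).

Lemma certifies_normal P L es c : certifies q phis L c -> perm_table q es ->
  contains_lines P L es ->
  normal_at q phis P id_frame (ap es 0).
Proof.
case: c => [[i s] tau]; rewrite /certifies; set d := line_images _ _ _ _.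
case/and5P=> lt_i perm_s perm_tau perm_d /andP[/eqP d0 /allP emb] perm_es P_es.
exists i, s, tau, (comp_table es d); split=> //; last first.
  by rewrite nth_comp_table ?d0 // (perm_table_size perm_d) ltnW.
split=> // [|p j L_p]; first exact: perm_comp_table.
have [over_p lt_j] := normal_form_word (all_nthP [::] forms i lt_i) L_p.
have [/eqP size_p _] := andP over_p.
have sg : relabelling 3 q s (nseq 3 tau) by rewrite /relabelling perm_s /= perm_tau.
have := emb _ L_p; rewrite (relabel_rcons _ _ sg) // => /P_es.
by rewrite nth_comp_table ?(perm_table_size perm_d) // /comp_frame map_nseq comp_table_iota.
Qed.

Section TwoLines.
Variables (P : word -> Prop) (pi sg : table) (e0 e1 : nat).
Hypotheses (mdsP : mds q 4 2 P) (perm_pi : perm_table q pi) (perm_sg : perm_table q sg).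
Hypotheses (lt_e0 : e0 < q) (lt_e1 : e1 < q) (ne_e01 : e0 != e1).
Hypotheses (Pl0 : contains_line P (diagonal q) e0) (Pl1 : contains_line P (graph q pi sg) e1).

Lemma normal_at_listed pairs cs : (pi, pairs) \in rs -> (sg, cs) \in pairs ->
  normal_at q phis P id_frame e0.
Proof.
move=> rs_pi pairs_sg.
have [L comp_L [es [perm_es <- P_es]]] :=
  completion_exists mdsP perm_pi lt_e0 lt_e1 ne_e01 Pl0 Pl1.
have /allP/(_ _ pairs_sg)/= := allP certified _ rs_pi; rewrite all2E => /andP[/eqP size_cs].
move/(all_nthP ([::], (0, [::], [::])))/(_ (index L (completions q pi sg))).
rewrite size_zip -size_cs minnn index_mem nth_zip // => /(_ comp_L) /=.
by rewrite nth_index // => /certifies_normal; apply.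
Qed.

Lemma lines_discordant : pi \in derangements q /\ sg \in discordants q pi.
Proof.
have [size_pi size_sg] := (perm_table_size perm_pi, perm_table_size perm_sg).
have P_e0 := (contains_diagonalP P q e0).1 Pl0.
have P_e1 := (contains_graphP P q pi sg e1).1 Pl1.
have meet_once i j a b : positions 4 2 [:: i; j] -> a < q -> b < q ->
    ap [:: b; b; b; e0] i = ap [:: a; ap pi a; ap sg a; e1] i ->
    ap [:: b; b; b; e0] j = ap [:: a; ap pi a; ap sg a; e1] j -> False.
  move=> pos_ij lt_a lt_b eq_i eq_j.
  by case: (plane_inj mdsP pos_ij (P_e0 b lt_b) (P_e1 a lt_a) eq_i eq_j) => _ _ _; apply/eqP.
have disc_pi : discordant idx pi.
  apply: (discordantI _ size_pi) => [|a lt_a]; rewrite ?size_iota // nth_iota0 //.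
  by apply/eqP => eq_a; apply: (@meet_once 0 1 a a).
have disc_sg : discordant idx sg.
  apply: (discordantI _ size_sg) => [|a lt_a]; rewrite ?size_iota // nth_iota0 //.
  by apply/eqP => eq_a; apply: (@meet_once 0 2 a a).
have disc_pi_sg : discordant pi sg.
  apply: discordantI size_pi size_sg _ => a lt_a; apply/eqP => eq_a.
  by apply: (@meet_once 1 2 a (ap pi a)); rewrite ?(perm_table_lt perm_pi).
by rewrite !mem_filter !mem_permutations disc_pi disc_sg disc_pi_sg.
Qed.

Lemma normal_at_sends s h pi' sg' : perm_table 3 s -> perm_table q h ->
  perm_table q pi' -> perm_table q sg' -> sends s h (graph q pi' sg') (graph q pi sg) ->
  (forall Q, mds q 4 2 Q -> contains_line Q (diagonal q) e0 ->
     contains_line Q (graph q pi' sg') e1 -> normal_at q phis Q id_frame e0) ->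
  normal_at q phis P id_frame e0.
Proof.
move=> perm_s perm_h perm_pi' perm_sg' /allP sent normal_Q.
have sh : relabelling 3 q s (nseq 3 h) by rewrite /relabelling perm_s /= perm_h.
have Q_line l e : e < q -> all (over 3 q) l ->
    {in l, forall p, P (rcons (relabel s (nseq 3 h) p) e)} ->
    contains_line (relabel_lines q P s (nseq 3 h)) l e.
  by move=> lt_e /allP over_l Pl p l_p; apply/relabel_linesE; rewrite ?over_l //; apply: Pl.
apply: (normal_at_relabel (m' := id_frame) forms sh frame_id frame_id perm_h) => [i x lt_i lt_x|].
  by rewrite !nth_nseq lt_i (perm_table_lt perm_s lt_i) !nth_iota0 ?(perm_table_lt perm_h).
apply: normal_Q; first exact: mds_relabel_lines.
  apply: Q_line => //; first by apply: over_graph; apply: perm_table_iota.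
  move=> _ /mapP[a + ->]; rewrite mem_iota0 => lt_a; rewrite !nth_iota0 //.
  rewrite (relabel_nseq (n := 3)) //.
  exact: (contains_diagonalP P q e0).1 Pl0 _ (perm_table_lt perm_h lt_a).
by apply: Q_line => [||p l_p]; rewrite ?over_graph //; apply/Pl1/sent.
Qed.
End TwoLines.

Lemma normal_at_representative P pi pairs sg e0 e1 : mds q 4 2 P -> (pi, pairs) \in rs ->
  e0 < q -> e1 < q -> e0 != e1 -> perm_table q sg -> contains_line P (diagonal q) e0 ->
  contains_line P (graph q pi sg) e1 -> normal_at q phis P id_frame e0.
Proof.
move=> mdsP rs_pi lt_e0 lt_e1 ne_e01 perm_sg Pl0 Pl1.
have /andP[perm_pi _] := allP wf _ rs_pi.
have [_ disc_sg] := lines_discordant mdsP perm_pi perm_sg ne_e01 Pl0 Pl1.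
have /andP[_ /allP/(_ _ rs_pi)/allP/(_ _ disc_sg)] := cover.
case/hasP=> s; rewrite mem_permutations => perm_s; cbv zeta; set t := find _ _ => /hasP[c _].
case/hasP=> [[sg' cs]] pairs_sg'; case: eqP => // _ /andP[perm_k sent].
have rs_t : nth ([::], [::]) rs t \in rs.
  by rewrite mem_nth // ltnNge; apply: contraL pairs_sg' => /(nth_default ([::], [::]))->.
case: (nth _ rs t) rs_t pairs_sg' sent => pi' pairs' rs_pi' pairs_sg' sent.
have /andP[perm_pi' /allP/(_ _ pairs_sg') perm_sg'] := allP wf _ rs_pi'.
apply: (normal_at_sends mdsP lt_e0 lt_e1 Pl0 Pl1 perm_s perm_k perm_pi' perm_sg' sent) => //.
move=> Q mdsQ Ql0 Ql1.
exact: (normal_at_listed mdsQ perm_pi' lt_e0 lt_e1 ne_e01 Ql0 Ql1 rs_pi' pairs_sg').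
Qed.

Lemma normal_at_diagonal P e0 : mds q 4 2 P -> e0 < q -> contains_line P (diagonal q) e0 ->
  normal_at q phis P id_frame e0.
Proof.
move=> mdsP lt_e0 Pl0.
have [e1 lt_e1 ne_e01] : exists2 e1, e1 < q & e0 != e1.
  by exists (e0 == 0); [case: eqP => // _; apply: ltnW | case: (e0)].
have [pi [sg [perm_pi perm_sg Pl1]]] := plane_line mdsP lt_e1.
have [disc_pi _] := lines_discordant mdsP perm_pi perm_sg ne_e01 Pl0 Pl1.
have /andP[/allP/(_ _ disc_pi)/andP[perm_h /hasP[[pi' pairs] rs_pi' /eqP conj_h]] _] := cover.
set h := cycle_listing q pi in perm_h conj_h; have size_h := perm_table_size perm_h.
have /andP[perm_pi' _] := allP wf _ rs_pi'.
pose sg' := [seq index (ap sg (ap h a)) h | a <- idx].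
have nth_sg' a : a < q -> ap h (ap sg' a) = ap sg (ap h a).
  by move=> lt_a; rewrite nth_map_iota // (perm_table_index perm_h) // !perm_table_lt.
have perm_sg' : perm_table q sg'.
  apply: perm_tableI => [|a lt_a|a b lt_a lt_b eq_ab]; first by rewrite size_map size_iota.
    by rewrite nth_map_iota // (perm_table_index_lt perm_h) // !perm_table_lt.
  apply: (perm_table_inj perm_h) => //.
  by apply: (perm_table_inj perm_sg); rewrite ?(perm_table_lt perm_h) // -!nth_sg' // eq_ab.
have sent : sends (iota 0 3) h (graph q pi' sg') (graph q pi sg).
  apply/allP => _ /mapP[a + ->]; rewrite mem_iota0 => lt_a; rewrite /relabel /=.
  rewrite nth_sg' // -[ap h (ap pi' a)]nth_comp_table ?(perm_table_size perm_pi') // -conj_h.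
  by rewrite nth_comp_table ?size_h // mem_graph // (perm_table_lt perm_h).
have perm_id := perm_table_iota 3.
apply: (normal_at_sends mdsP lt_e0 lt_e1 Pl0 Pl1 perm_id perm_h perm_pi' perm_sg' sent) => //.
move=> Q mdsQ; exact: (normal_at_representative mdsQ rs_pi' lt_e0 lt_e1 ne_e01 perm_sg').
Qed.

Theorem plane_classification : classifies q phis.
Proof.
move=> P m e mdsP lt_e frame_m Pl; have [size_m perm_m] := frameP frame_m.
have m_relabelling : relabelling 3 q (iota 0 3) m.
  by apply/relabellingP; split; rewrite ?perm_table_iota.
apply: (normal_at_relabel forms m_relabelling frame_m frame_id (perm_table_iota q)).
  by move=> i x lt_i lt_x; rewrite [iota 0 3]lock nth_nseq -lock nth_iota0 // lt_i !nth_iota0.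
apply: normal_at_diagonal => //; first exact: mds_relabel_lines.
apply/contains_diagonalP => a lt_a.
have over_aaa : over 3 q [:: a; a; a] by rewrite /over /= lt_a.
apply/(relabel_linesE P m_relabelling over_aaa lt_e)/Pl/mapP; exists a; rewrite ?mem_iota0 //.
by case: (m) size_m => [|? [|? [|? []]]].
Qed.
End Classification.

(** * Planes in cubes *)

Definition contains_plane (X : word -> Prop) (L : plane) : Prop :=
  {in plane_words L, forall w, X (rcons w 0)}.

Definition excluded q (L : plane) : Prop := forall X i b s g,
  mds q 5 3 X -> i < 5 -> b < q -> relabelling 4 q s g ->
  ~ {in plane_words L, forall w, slice i b X (relabel s g w)}.

Lemma over_normal_form q L : normal_form q L -> {in plane_words L, forall w, over 4 q w}.
Proof.
move=> form_L w /allpairsPdep[j [p [lt_j p_in ->]]].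
have L_pj : rcons p j \in plane_words L by rewrite mem_plane_words -mem_iota0 lt_j.
have [/andP[/eqP size_p lt_p] lt_jq] := normal_form_word form_L L_pj.
by rewrite /over size_rcons size_p all_rcons /= lt_jq.
Qed.

Lemma excludedI q L : normal_form q L ->
  (forall X, mds q 5 3 X -> ~ contains_plane X L) -> excluded q L.
Proof.
move=> form_L no_cube X i b s g mdsX lt_i lt_b sg Xw.
have sg' := relabelling_insert i sg (perm_swap0_table lt_b).
apply: (no_cube _ (mds_pullback sg' mdsX)) => w L_w.
have over_w := over_normal_form form_L L_w; have [/eqP size_w _] := andP over_w.
have gt0_q : 0 < q by apply: leq_ltn_trans lt_b.
have [perm_s size_g _] := relabellingP _ _ _ _ sg.
have lt_s : all (gtn 4) s by apply/allP => k; rewrite (mem_perm_table perm_s).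
split; first by rewrite -(insert_size _ size_w) over_insert.
rewrite relabel_insert ?(perm_table_size perm_s) // nth_swap0_table //.
exact: Xw.
Qed.

Lemma excludedE q L X : 0 < q -> normal_form q L -> excluded q L -> mds q 5 3 X ->
  ~ contains_plane X L.
Proof.
move=> gt0_q form_L excl_L mdsX XL.
have id_relabelling : relabelling 4 q (iota 0 4) (nseq 4 (iota 0 q)).
  by rewrite /relabelling /= perm_table_iota.
apply: (excl_L X 4 0 _ _ mdsX _ gt0_q id_relabelling) => // w L_w.
have over_w := over_normal_form form_L L_w; have [/eqP size_w _] := andP over_w.
by rewrite relabel_id // /slice insert_size //; apply: XL.
Qed.

Lemma excluded_embeds q s g L L' : 0 < q -> normal_form q L' -> relabelling 4 q s g ->
  embeds s g L L' -> excluded q L -> excluded q L'.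
Proof.
move=> gt0_q form_L' sg /allP emb excl_L; apply: excludedI => // X mdsX XL'.
apply: (excl_L X 4 0 s g) => // w L_w.
by rewrite /slice insert_size ?(size_relabel sg) //; apply/XL'/emb.
Qed.

Definition enumerates (P : word -> Prop) (L : plane) (d : table) : Prop :=
  contains_lines P L d /\
  (forall w, P w -> exists p j, rcons p j \in plane_words L /\ w = rcons p (ap d j)).

Definition placed (phis : seq plane) (m : seq table) (h : certificate) : plane :=
  let: (i, s, tau) := h in
  [seq [seq relabel s (comp_frame m tau) p | p <- l] | l <- nth [::] phis i].

Section Realizes.
Variables (q : nat) (P : word -> Prop) (L : plane).
Variables (s : seq nat) (tau : table) (m : seq table) (d : table).
Hypotheses (mdsP : mds q 4 2 P) (form_L : normal_form q L) (frame_m : frame q m).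
Hypothesis real : realizes q P L s tau m d.
Let g := comp_frame m tau.

Lemma realizes_onto w : P w ->
  exists p j, rcons p j \in plane_words L /\ w = rcons (relabel s g p) (ap d j).
Proof.
move=> Pw; have [perm_s perm_tau perm_d P_L] := real.
have sg := relabelling_frame perm_s perm_tau frame_m.
have [_ _ /(_ 0 isT) perm_g] := relabellingP _ _ _ _ sg.
have [lt_w0 lt_w3] := (plane_lt mdsP Pw (isT : 0 < 4), plane_lt mdsP Pw (isT : 3 < 4)).
have lt_j := perm_table_index_lt perm_d lt_w3; set j := index _ d in lt_j.
have lt_s0 : ap s 0 < 3 by apply: perm_table_lt perm_s _ _.
have [p L_p px] := normal_form_point form_L lt_s0 (perm_table_index_lt perm_g lt_w0) lt_j.
exists p, j; split=> //.
apply: (plane_inj mdsP (isT : positions 4 2 [:: 0; 3]) Pw (P_L _ _ L_p)).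
  rewrite nth_rcons (size_relabel sg) nth_relabel ?(perm_table_size perm_s) // px.
  by rewrite (perm_table_index perm_g).
by rewrite nth_rcons (size_relabel sg) (perm_table_index perm_d).
Qed.
End Realizes.

Lemma realizes_enumerates q P phis i s tau m d : mds q 4 2 P -> normal_form q (nth [::] phis i) ->
  frame q m -> realizes q P (nth [::] phis i) s tau m d ->
  enumerates P (placed phis m (i, s, tau)) d.
Proof.
move=> mdsP form frame_m real; split=> [p' j|w].
  rewrite mem_plane_words size_map => /andP[lt_j]; rewrite (nth_map [::]) // => /mapP[p p_in ->].
  by case: real => _ _ _; apply; rewrite mem_plane_words lt_j.
case/(realizes_onto mdsP form frame_m real)=> p [j [L_p ->]].
exists (relabel s (comp_frame m tau) p), j; split=> //.
move: L_p; rewrite !mem_plane_words size_map => /andP[lt_j p_in].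
by rewrite lt_j (nth_map [::]) // map_f.
Qed.

(** * Search for the planes of a cube *)

Definition on c (ps : seq word) : seq word := [seq omit c p | p <- ps & ap p c == 0].
Definition off c (ps : seq word) : seq word := [seq omit c p | p <- ps & ap p c != 0].

Lemma mem_on c ps p : p \in ps -> ap p c = 0 -> omit c p \in on c ps.
Proof. by move=> ps_p pc; apply: map_f; rewrite mem_filter pc eqxx. Qed.

Section Trace.
Variable q : nat.

(* For each [y], the line of [L] that contains a point with [0] in position [t] and
   [y] in the first remaining position: the other entry of this point, and the
   entries of the points off the plane on which position [t] is [0]. *)
Definition trace t (L : plane) : seq (nat * seq word) :=
  [seq let l := nth [::] L (find (has (fun p => (ap p t == 0) && (ap p (bump t 0) == y))) L) in
       (ap (head [::] (on t l)) 1, off t l) | y <- iota 0 q].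

Definition conflict (D D' : seq (nat * seq word)) : bool :=
  if unzip1 D == unzip1 D' then has (fun dd => has (mem dd.1.2) dd.2.2) (zip D D') else true.

Lemma nth_trace P L d t y w : mds q 4 2 P -> enumerates P L d -> t < 3 ->
  y < q -> P w -> ap w t = 0 -> ap w (bump t 0) = y ->
  exists l, nth (0, [::]) (trace t L) y = (ap w (bump t 1), off t l) /\ contains_line P l (ap w 3).
Proof.
move=> mdsP [LP PL] lt_t lt_y Pw wt wy.
have size3 p j : rcons p j \in plane_words L -> size p = 3.
  by move/LP/(plane_over mdsP)/overP => [/eqP]; rewrite size_rcons eqSS => /eqP.
have [pos_y pos_e] : positions 4 2 [:: t; bump t 0] /\ positions 4 2 [:: t; 3].
  by case: (t) lt_t => [|[|[|]]].
have [lt_b0 lt_b1] : bump t 0 < 3 /\ bump t 1 < 3 by move: lt_t; rewrite /bump; lia.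
rewrite nth_map_iota //; set on_y := has _; set j := find on_y L.
have hit : has on_y L.
  have [p [j' [L_p def_w]]] := PL w Pw; have size_p := size3 p j' L_p.
  have:= L_p; rewrite mem_plane_words => /andP[lt_j' p_in].
  apply/hasP; exists (nth [::] L j'); first exact: mem_nth.
  apply/hasP; exists p => //; move: wt wy.
  by rewrite def_w !nth_rcons size_p lt_t lt_b0 /= => -> ->; rewrite !eqxx.
have lt_j : j < size L by rewrite -has_find.
have /hasP[p p_in /andP[/eqP pt /eqP py]] := nth_find [::] hit; rewrite -/j in p_in.
have L_j p' : p' \in nth [::] L j -> rcons p' j \in plane_words L.
  by rewrite mem_plane_words lt_j.
have dj : ap d j = ap w 3.
  have size_p := size3 p j (L_j p p_in).
  have eq_w : w = rcons p (ap d j).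
    apply: (plane_inj mdsP pos_y Pw (LP _ _ (L_j p p_in))).
      by rewrite nth_rcons size_p lt_t pt.
    by rewrite nth_rcons size_p lt_b0 py.
  by rewrite eq_w nth_rcons size_p.
exists (nth [::] L j); split=> [|p' /L_j/LP]; last by rewrite dj.
have: head [::] (on t (nth [::] L j)) \in on t (nth [::] L j).
  by have := mem_on p_in pt; case: (on t _) => //= *; rewrite mem_head.
case/mapP=> p'; rewrite mem_filter => /andP[/eqP p't p'_in] head_on.
have size_p' := size3 p' j (L_j p' p'_in).
have eq_w : w = rcons p' (ap d j).
  by apply: (plane_inj mdsP pos_e Pw (LP _ _ (L_j p' p'_in))); rewrite nth_rcons size_p' ?lt_t ?p't.
by cbv zeta; rewrite head_on nth_omit eq_w nth_rcons size_p' lt_b1.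
Qed.
End Trace.

Section Candidates.
Variables (q : nat) (phis : seq plane) (nlin : nat).
Notation idx := (iota 0 q).

(* Entry [z] at [(x, y)] if [(x, y, z)] is listed, and [q] if there is no such [z]. *)
Definition lookup_table (ps : seq word) : seq table :=
  [seq [seq nth q [seq ap p 2 | p <- ps & (ap p 0 == x) && (ap p 1 == y)] 0 | y <- idx] | x <- idx].

Definition avoids (T : seq table) (tau : table) (p : word) : bool :=
  if p is [:: x; y; z] then ap (tab T (ap tau x)) (ap tau y) != ap tau z else false.

(* The points off line 0 with their coordinates permuted by [s], grouped by their
   largest entry: a group can be tested once a renaming is known up to this entry. *)
Definition strata s (L : plane) : seq (seq word) :=
  let ps := [seq [seq ap p i | i <- s] | p <- flatten (behead L)] in
  [seq [seq p <- ps | foldr maxn 0 p == x] | x <- idx].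

Fixpoint avoiding_tables (T : seq table) (pss : seq (seq word)) (pre avail : seq nat) : seq table :=
  if pss is ps :: pss' then
    flatten [seq (let pre' := rcons pre x in
      if all (avoids T pre') ps then avoiding_tables T pss' pre' (rem x avail) else [::])
    | x <- avail]
  else [:: pre].

(* Renamings of a linear plane ([i >= nlin]) may be assumed to fix 0 and 1, by
   [affine_invariant]. *)
Definition fixed_symbols i : nat := if i < nlin then 0 else 2.

Definition cut_frame c (L : plane) : seq table :=
  let ps := on c (plane_words L) in [seq column i ps | i <- iota 0 3].

Definition forbidden c (L : plane) : seq word :=
  let m := cut_frame c L in
  [seq [seq index (ap p i) (tab m i) | i <- iota 0 3] | p <- off c (plane_words L)].

Definition candidates c (L : plane) k : seq certificate :=
  let T := lookup_table (forbidden c L) in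
  flatten [seq (let n := fixed_symbols i in
    [seq (i, s, tau) | s <- permutations (iota 0 3),
       tau <- avoiding_tables T (drop n (strata s (nth [::] phis i))) (iota 0 n) (iota n (q - n))])
  | i <- iota k (size phis - k)].

(* Planes [i >= k] that can be the slice [x3 = 0] of a cube with [L] in the slice
   [x4 = 0]: some candidate for the slice [x0 = 0] must fit. *)
Definition survivors (L : plane) k : seq certificate :=
  let Ds := [seq trace q 2 (placed phis (cut_frame 0 L) h) | h <- candidates 0 L k] in
  [seq h <- candidates 3 L k |
    let D := trace q 0 (placed phis (cut_frame 3 L) h) in has (fun D' => ~~ conflict D D') Ds].

Definition cuts_wf (L : plane) : bool :=
  (cut_frame 3 L == nseq 3 idx) && frame q (cut_frame 0 L).

Lemma lookup_tableP ps x y z : x < q -> y < q -> z < q -> ap (tab (lookup_table ps) x) y = z ->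
  exists p, [/\ p \in ps, ap p 0 = x, ap p 1 = y & ap p 2 = z].
Proof.
move=> lt_x lt_y lt_z; rewrite !nth_map_iota //; set sel := [seq p <- ps | _].
case def_sel: sel => [|p sel'] /= eq_z; first by rewrite eq_z ltnn in lt_z.
have: p \in sel by rewrite def_sel mem_head.
by rewrite mem_filter => /andP[/andP[/eqP px /eqP py] ps_p]; exists p.
Qed.

Lemma mem_avoiding_tables T pss pre avail tau : pre = take (size pre) tau ->
  size tau = size pre + size pss -> perm_eq avail (drop (size pre) tau) ->
  (forall i p, i < size pss -> p \in nth [::] pss i -> avoids T (take (size pre + i).+1 tau) p) ->
  tau \in avoiding_tables T pss pre avail.
Proof.
elim: pss pre avail => [|ps pss IHpss] pre avail def_pre size_tau perm_avail ok /=.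
  by rewrite inE def_pre take_oversize // size_tau addn0.
have lt_pre : size pre < size tau by rewrite size_tau addnS ltnS leq_addr.
have def_pre' : rcons pre (ap tau (size pre)) = take (size pre).+1 tau.
  by rewrite (take_nth 0) // -def_pre.
have def_drop : drop (size pre) tau = ap tau (size pre) :: drop (size pre).+1 tau.
  exact: drop_nth.
apply/flattenP; eexists.
  by apply/mapP; exists (ap tau (size pre)) => //; rewrite (perm_mem perm_avail) def_drop mem_head.
rewrite ifT; last by apply/allP => p ps_p; rewrite def_pre' -(addn0 (size pre)); apply: (ok 0).
apply: IHpss; rewrite ?size_rcons // ?addSnnS //.
  rewrite -(perm_cons (ap tau (size pre))) -def_drop -(permPr perm_avail) perm_sym.
  by apply: perm_to_rem; rewrite (perm_mem perm_avail) def_drop mem_head.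
by move=> i p lt_i p_in; rewrite addSnnS; apply: (ok i.+1).
Qed.

Lemma avoids_take T tau p n : foldr maxn 0 p < n -> avoids T (take n tau) p = avoids T tau p.
Proof.
case: p => [|x [|y [|z [|? ?]]]] //=; rewrite maxn0 !gtn_max => /and3P[lt_x lt_y lt_z].
by rewrite !nth_take.
Qed.

Lemma mem_strata s L p x : x < q -> p \in nth [::] (strata s L) x ->
  foldr maxn 0 p = x /\
  exists p' j, rcons p' j \in plane_words L /\ p = [seq ap p' i | i <- s].
Proof.
move=> lt_x; rewrite nth_map_iota // mem_filter => /andP[/eqP max_p /mapP[p' + def_p]].
case/flattenP=> l /(nthP [::])[j lt_j <-] p'_in; split=> //; exists p', j.+1.
rewrite mem_plane_words -nth_behead p'_in andbT; split=> //.
by move: lt_j; rewrite size_behead; case: (size L).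
Qed.

Definition normalised i (tau : table) : Prop :=
  take (fixed_symbols i) tau = iota 0 (fixed_symbols i).

Lemma mem_candidates c L k i s tau : 1 < q -> k <= i < size phis ->
  perm_table 3 s -> perm_table q tau -> normalised i tau ->
  (forall p j, rcons p j \in plane_words (nth [::] phis i) ->
     avoids (lookup_table (forbidden c L)) tau [seq ap p i | i <- s]) ->
  (i, s, tau) \in candidates c L k.
Proof.
move=> gt1_q /andP[le_ki lt_i] perm_s perm_tau norm_tau ok.
apply/flattenP; eexists.
  by apply/mapP; exists i => //; rewrite mem_iota le_ki subnKC // ltnW // (leq_ltn_trans le_ki).
have le_nq : fixed_symbols i <= q by rewrite /fixed_symbols; case: ifP.
have size_strata : size (strata s (nth [::] phis i)) = q by rewrite size_map size_iota.
cbv zeta; apply/allpairsPdep; exists s, tau; split=> //; first by rewrite mem_permutations.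
have size_tau := perm_table_size perm_tau.
apply: mem_avoiding_tables => [|||x p]; rewrite ?size_iota //.
- by rewrite size_drop size_strata subnKC.
- rewrite -(perm_cat2l (iota 0 (fixed_symbols i))) -[in X in perm_eq _ X]norm_tau cat_take_drop.
  by rewrite perm_sym -[X in iota X _]add0n -iotaD subnKC.
rewrite size_drop size_strata nth_drop => lt_x p_in.
have [|max_p [p' [j [L_p' def_p]]]] := mem_strata _ p_in; first by rewrite -ltn_subRL.
by rewrite avoids_take ?max_p // def_p; apply: ok L_p'.
Qed.
End Candidates.

Section AffineNormalisation.
Variable q : nat.

Definition affine_table x y : table := [seq (x + (q + y - x) * t) %% q | t <- iota 0 q].

(* Affine substitutions of the symbols permute the lines of a linear plane. *)
Definition affine_invariant (L : plane) : bool :=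
  all (fun x => all (fun y => (x == y) ||
    (let a := affine_table x y in
     let b := affine_table 0 ((q + y - x) %% q) in
     [&& perm_table q a, perm_table q b, ap a 0 == x, ap a 1 == y, ap b 0 == 0
       & embeds (iota 0 4) [:: a; a; a; b] L L])) (iota 0 q)) (iota 0 q).

Lemma realizes_normalised P L s tau m d : 1 < q -> normal_form q L -> frame q m ->
  affine_invariant L -> realizes q P L s tau m d ->
  exists tau' d', [/\ realizes q P L s tau' m d', take 2 tau' = [:: 0; 1] & ap d' 0 = ap d 0].
Proof.
move=> gt1_q form_L frame_m affine_L [perm_s perm_tau perm_d real].
have gt0_q : 0 < q := ltnW gt1_q.
have [lt_x lt_y] := (perm_table_index_lt perm_tau gt0_q, perm_table_index_lt perm_tau gt1_q).
have ne_xy : index 0 tau != index 1 tau.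
  by apply/eqP=> /(congr1 (ap tau)); rewrite !(perm_table_index perm_tau).
have := allP affine_L (index 0 tau); rewrite mem_iota0 => /(_ lt_x)/allP/(_ (index 1 tau)).
rewrite mem_iota0 (negbTE ne_xy) => /(_ lt_y); cbv zeta; set a := affine_table _ _.
set b := affine_table _ _; rewrite orFb.
case/and5P=> perm_a perm_b /eqP a0 /eqP a1 /andP[/eqP b0 /allP emb].
have [size_a size_b] := (perm_table_size perm_a, perm_table_size perm_b).
exists (comp_table tau a), (comp_table d b); split; last by rewrite nth_comp_table ?size_b ?b0.
  split=> [|||p j L_p]; rewrite ?perm_comp_table //.
  have [over_p lt_j] := normal_form_word form_L L_p; have [/eqP size_p _] := andP over_p.
  have := emb _ L_p.
  rewrite -[iota 0 4]/(rcons (iota 0 3) 3) -[[:: a; a; a; b]]/(rcons (nseq 3 a) b).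
  have id_a : relabelling 3 q (iota 0 3) (nseq 3 a) by rewrite /relabelling /= perm_a.
  rewrite (relabel_rcons _ _ id_a) // => /real; have [size_m _] := frameP frame_m.
  set h := comp_frame m (comp_table tau a).
  rewrite (relabel_comp (n := 3) (q := q) (h := h)) ?perm_table_iota //.
    by rewrite comp_table_iota // nth_comp_table ?size_b.
  move=> i x lt_i lt_xq; have lt_si := perm_table_lt perm_s lt_i.
  rewrite nth_nseq lt_si !nth_comp_frame ?size_map ?size_m ?size_iota //.
    by rewrite nth_comp_table ?size_a.
  by rewrite (perm_table_size perm_tau) perm_table_lt.
have def_tau' : [:: ap (comp_table tau a) 0; ap (comp_table tau a) 1] = [:: 0; 1].
  by rewrite !nth_comp_table ?size_a // a0 a1 !(perm_table_index perm_tau).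
have: 1 < size (comp_table tau a) by rewrite size_map size_a.
by case: (comp_table tau a) def_tau' => [|? [|? t]] //= [-> ->]; rewrite take0.
Qed.
End AffineNormalisation.

Lemma insert_omit_rcons q c w e : c < 4 -> over 4 q w ->
  insert c (ap w c) (rcons (omit c w) e) = rcons w e.
Proof.
move=> lt_c /andP[/eqP size_w _].
by rewrite insert_rcons ?insert_omit ?size_omit ?size_w.
Qed.

Section Slices.
Variables (q : nat) (X : word -> Prop) (L : plane) (c : nat).
Hypotheses (mdsX : mds q 5 3 X) (form_L : normal_form q L).
Hypothesis XL : contains_plane X L.
Hypotheses (lt_c : c < 4) (frame_cut : frame q (cut_frame c L)).

Let size_omit_word w : w \in plane_words L -> size (omit c w) = 3.
Proof. by case/(over_normal_form form_L)/andP=> /eqP size_w _; rewrite size_omit size_w. Qed.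

Lemma contains_cut_line : contains_line (slice c 0 X) (frame_line q (cut_frame c L)) 0.
Proof.
move=> _ /mapP[a + ->]; rewrite mem_iota0 => lt_a.
set ps := on c (plane_words L).
have lt_aps : a < size ps.
  have [_ perm_m] := frameP frame_cut; have := perm_table_size (perm_m 0 isT).
  by rewrite (nth_map 0) ?size_iota // size_map => ->.
have /mapP[w + def_p] := mem_nth [::] lt_aps; rewrite mem_filter => /andP[/eqP wc L_w].
have -> : [seq ap t a | t <- cut_frame c L] = omit c w.
  rewrite -map_comp -[RHS](mkseq_nth 0) size_omit_word //; apply/eq_in_map => i _ /=.
  by rewrite (nth_map [::]) // def_p.
rewrite /slice -[X in insert _ X]wc (insert_omit_rcons _ lt_c (over_normal_form form_L L_w)).
exact: XL.
Qed.

Lemma cut_slice_entry w e : w \in plane_words L -> slice c 0 X (rcons (omit c w) e) -> ap w c = 0.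
Proof.
move=> L_w Xp; have [size_w _] := overP _ _ _ (over_normal_form form_L L_w).
have size_p := size_omit_word L_w.
have pos_c : positions 5 3 [:: bump c 0; bump c 1; bump c 2] by case: (c) lt_c => [|[|[|[|]]]].
have eq_words : insert c 0 (rcons (omit c w) e) = rcons w 0.
  apply: (mds_agree mdsX pos_c Xp (XL L_w)); set u := insert _ _ _.
  suff agree k : k < 3 -> ap u (bump c k) = ap (rcons w 0) (bump c k).
    by rewrite /= !agree // !eqxx.
  move=> lt_k; have lt_b : bump c k < 4 by move: lt_c; rewrite /bump; lia.
  rewrite nth_insert_bump ?size_rcons ?size_p ?(ltnW lt_c) //.
  by rewrite !nth_rcons size_p lt_k size_w lt_b nth_omit.
have := congr1 (ap^~ c) eq_words.
by rewrite nth_insert ?size_rcons ?size_p ?(ltnW lt_c) // nth_rcons size_w lt_c.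
Qed.

Lemma realizes_avoids phi s tau d p j : normal_form q phi ->
  realizes q (slice c 0 X) phi s tau (cut_frame c L) d -> rcons p j \in plane_words phi ->
  avoids (lookup_table q (forbidden c L)) tau [seq ap p i | i <- s].
Proof.
move=> form_phi [perm_s perm_tau _ real] phi_p.
have [over_p _] := normal_form_word form_phi phi_p; have size_s := perm_table_size perm_s.
have [size_m perm_m] := frameP frame_cut; have size_tau := perm_table_size perm_tau.
have lt_ps i : i < 3 -> ap p (ap s i) < q.
  by move=> lt_i; have [_] := overP _ _ _ over_p; apply; apply: perm_table_lt.
have def_s : s = [:: ap s 0; ap s 1; ap s 2] by case: (s) size_s => [|? [|? [|? []]]].
rewrite def_s /=; apply/eqP => /lookup_tableP[]; rewrite ?(perm_table_lt perm_tau) ?lt_ps //.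
move=> f [/mapP[p' /mapP[w + def_p'] def_f] f0 f1 f2].
rewrite mem_filter => /andP[/eqP wc L_w]; apply: wc.
have [size_w lt_w] := overP _ _ _ (over_normal_form form_L L_w).
have eq_p' : relabel s (comp_frame (cut_frame c L) tau) p = omit c w.
  apply: (@eq_from_nth _ 0) => [|i].
    by rewrite size_map size_iota size_s size_omit_word.
  rewrite size_map size_iota size_s => lt_i.
  rewrite nth_relabel ?size_s // nth_comp_frame ?size_m ?size_tau ?lt_ps //.
  rewrite -def_p'; have lt_p'i : ap p' i < q by rewrite def_p' nth_omit lt_w // /bump; lia.
  rewrite -[RHS](perm_table_index (perm_m i lt_i) lt_p'i); congr (ap _ _).
  have <- : ap f i = index (ap p' i) (tab (cut_frame c L) i).
    by rewrite def_f nth_map_iota.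
  by move: lt_i; case: (i) => [|[|[|]]].
by apply: (cut_slice_entry L_w (e := ap d j)); rewrite -eq_p'; apply: real.
Qed.
End Slices.

Section Survivors.
Variables (q : nat) (phis : seq plane) (nlin : nat).
Hypotheses (gt1_q : 1 < q) (forms : all (normal_form q) phis).
Hypothesis affine : all (affine_invariant q) (drop nlin phis).
Hypothesis classified : classifies q phis.

Let form i : i < size phis -> normal_form q (nth [::] phis i).
Proof. by move=> lt_i; apply: (all_nthP [::] forms). Qed.

Variables (X : word -> Prop) (L : plane) (k : nat).
Hypotheses (mdsX : mds q 5 3 X) (form_L : normal_form q L) (cuts_L : cuts_wf q L).
Hypothesis XL : contains_plane X L.
Hypothesis excl : forall i, i < k -> excluded q (nth [::] phis i).

Let mds_slice0 c : c < 5 -> mds q 4 2 (slice c 0 X).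
Proof. by move=> lt_c; apply: mds_slice => //; apply: ltnW. Qed.

Lemma slice_realizes_index c i s tau m d : c < 5 -> i < size phis -> frame q m ->
  realizes q (slice c 0 X) (nth [::] phis i) s tau m d -> k <= i.
Proof.
move=> lt_c lt_i frame_m [perm_s perm_tau perm_d real]; rewrite leqNgt; apply/negP => lt_ik.
have sg := relabelling_frame perm_s perm_tau frame_m.
apply: (excl lt_ik mdsX lt_c (ltnW gt1_q) (relabelling_rcons sg perm_d)) => w phi_w.
have /allpairsPdep[j [p [_ _ def_w]]] := phi_w.
have phi_pj : rcons p j \in plane_words (nth [::] phis i) by rewrite -def_w.
have [/andP[/eqP size_p _] _] := normal_form_word (form lt_i) phi_pj.
by rewrite def_w (relabel_rcons _ _ sg) //; apply: real.
Qed.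

Lemma slice_candidate c : c < 4 -> frame q (cut_frame c L) ->
  exists i s tau d, [/\ k <= i < size phis, (i, s, tau) \in candidates q phis nlin c L k,
    realizes q (slice c 0 X) (nth [::] phis i) s tau (cut_frame c L) d & ap d 0 = 0].
Proof.
move=> lt_c frame_m; have gt0_q := ltnW gt1_q; have lt_c5 : c < 5 := ltnW lt_c.
have [i [s [tau [d [lt_i real d0]]]]] :=
  classified (mds_slice0 lt_c5) gt0_q frame_m (contains_cut_line form_L XL lt_c frame_m).
have le_ki : k <= i < size phis by rewrite (slice_realizes_index lt_c5 lt_i frame_m real).
have [tau' [d' [norm_tau' real' d'0]]] : exists tau' d', [/\ normalised nlin i tau',
    realizes q (slice c 0 X) (nth [::] phis i) s tau' (cut_frame c L) d' & ap d' 0 = 0].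
  rewrite /normalised /fixed_symbols; case: ltnP => [_|le_ni].
    by exists tau, d; rewrite take0.
  have aff_i : affine_invariant q (nth [::] phis i).
    apply: (allP affine); rewrite -(subnKC le_ni) -nth_drop mem_nth // size_drop.
    by rewrite ltn_sub2r // (leq_ltn_trans le_ni).
  have [tau' [d' [real' norm d'0]]] := realizes_normalised gt1_q (form lt_i) frame_m aff_i real.
  by exists tau', d'; rewrite d'0.
exists i, s, tau', d'; split=> //; have [perm_s perm_tau' _ _] := real'.
apply: mem_candidates => // p j phi_p.
exact: (realizes_avoids mdsX form_L XL lt_c frame_m (form lt_i) real' phi_p).
Qed.

Lemma no_conflict A d B b :
  enumerates (slice 3 0 X) A d -> enumerates (slice 0 0 X) B b ->
  conflict (trace q 0 A) (trace q 2 B) = false.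
Proof.
move=> enumA enumB; have gt0_q := ltnW gt1_q.
have [mdsA mdsB] := (mds_slice0 (isT : 3 < 5), mds_slice0 (isT : 0 < 5)).
have common y : y < q -> exists z e l l', [/\ nth (0, [::]) (trace q 0 A) y = (z, off 0 l),
    nth (0, [::]) (trace q 2 B) y = (z, off 2 l'),
    contains_line (slice 3 0 X) l e & contains_line (slice 0 0 X) l' e].
  move=> lt_y; have [_ _ exX] := mdsX.
  have [|j|w Xw eq_w] := exX [:: 0; 1; 3] (fun j => if j == 1 then y else 0); rewrite //.
    by case: ifP.
  have [/eqP size_w _] := andP (let: And3 overX _ _ := mdsX in overX w Xw).
  have [w0 w1 w3] : [/\ ap w 0 = 0, ap w 1 = y & ap w 3 = 0] by rewrite !eq_w.
  case: w size_w w0 w1 w3 Xw {eq_w} => [|w0 [|w1 [|z [|w3 [|e []]]]]] //= _ -> -> -> Xw.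
  have [Aw Bw] : slice 3 0 X [:: 0; y; z; e] /\ slice 0 0 X [:: y; z; 0; e] by [].
  have [l [eq_l line_l]] := nth_trace mdsA enumA (isT : 0 < 3) lt_y Aw erefl erefl.
  have [l' [eq_l' line_l']] := nth_trace mdsB enumB (isT : 2 < 3) lt_y Bw erefl erefl.
  by exists z, e, l, l'.
have size_trace t M : size (trace q t M) = q by rewrite size_map size_iota.
rewrite /conflict ifT; last first.
  apply/eqP/(@eq_from_nth _ 0) => [|y]; rewrite !size_map size_iota // => lt_y.
  have [z [e [l [l' [eq_l eq_l' _ _]]]]] := common y lt_y.
  by rewrite !(nth_map (0, [::])) ?size_trace // eq_l eq_l'.
apply/hasP => -[dd /(nthP ((0, [::]), (0, [::])))[y]].
rewrite size_zip !size_trace minnn nth_zip ?size_trace // => lt_y <-.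
have [z [e [l [l' [-> -> line_l line_l']]]]] := common y lt_y.
case/hasP=> u /mapP[p' + ->] /mapP[p +]; rewrite !mem_filter.
case/andP=> p'2 /line_l' Xp' /andP[p0 /line_l Xp] /= eq_u.
have [/eqP size_p _] := andP (plane_over mdsA Xp).
have [/eqP size_p' _] := andP (plane_over mdsB Xp').
rewrite !size_rcons in size_p size_p'.
case: p size_p p0 Xp eq_u => [|x [|y1 [|z1 []]]] //= _ ne_x Xp.
case: p' size_p' p'2 Xp' => [|y2 [|z2 [|j []]]] //= _ _ Xp' [eq_y eq_z].
have := mds_agree mdsX (isT : positions 5 3 [:: 1; 2; 4]) Xp Xp'.
by rewrite /= eq_y eq_z !eqxx => /(_ isT)[eq_x]; rewrite eq_x in ne_x.
Qed.

Lemma mem_survivors : exists i s tau d, [/\ k <= i < size phis,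
  (i, s, tau) \in survivors q phis nlin L k,
  realizes q (slice 3 0 X) (nth [::] phis i) s tau (nseq 3 (iota 0 q)) d & ap d 0 = 0].
Proof.
have /andP[/eqP cut3 frame0] := cuts_L.
have frame3 : frame q (cut_frame 3 L) by rewrite cut3; apply/frame_nseq/perm_table_iota.
have [i [s [tau [d [lt_i cand real d0]]]]] := slice_candidate (isT : 3 < 4) frame3.
have [i' [s' [tau' [d' [lt_i' cand' real' _]]]]] := slice_candidate (isT : 0 < 4) frame0.
exists i, s, tau, d; rewrite -cut3; split=> //; rewrite mem_filter cand andbT.
have [[_ lt_i2] [_ lt_i'2]] := (andP lt_i, andP lt_i').
apply/hasP; eexists; first exact: map_f cand'.
have enum3 := realizes_enumerates (mds_slice0 (isT : 3 < 5)) (form lt_i2) frame3 real.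
have enum0 := realizes_enumerates (mds_slice0 (isT : 0 < 5)) (form lt_i'2) frame0 real'.
by rewrite (no_conflict enum3 enum0).
Qed.
End Survivors.

Section Exclusions.
Variables (q : nat) (phis : seq plane) (nlin : nat) (xs : seq (nat * seq nat * seq table)).
Hypotheses (gt1_q : 1 < q) (forms : all (normal_form q) phis) (le_nlin : nlin <= size phis).
Hypothesis affine : all (affine_invariant q) (drop nlin phis).
Hypothesis classified : classifies q phis.

(* Either the search excludes plane [i], or plane [i0 < i] is equivalent to it. *)
Definition exclusions_check : bool :=
  all (fun i => let: (i0, s, g) := nth (0, [::], [::]) xs i in
    let L := nth [::] phis i in
    if i0 == i then cuts_wf q L && nilp (survivors q phis nlin L i)
    else [&& i0 < i, relabelling 4 q s g & embeds s g (nth [::] phis i0) L]) (iota 0 nlin).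

Lemma excluded_nonlinear : exclusions_check -> forall i, i < nlin -> excluded q (nth [::] phis i).
Proof.
move=> /allP check; elim/ltn_ind=> i IHi lt_i.
have form_i : normal_form q (nth [::] phis i).
  exact: all_nthP (leq_trans lt_i le_nlin).
have := check i; rewrite mem_iota0 => /(_ lt_i); case: (nth _ xs i) => [[i0 s] g].
case: eqP => [_ /andP[cuts_i /nilP none]|_ /and3P[lt_i0 sg emb]]; last first.
  by apply: excluded_embeds sg emb (IHi _ lt_i0 _) => //; [apply: ltnW | apply: ltn_trans lt_i0 _].
apply: excludedI => // X mdsX XL.
have [|j [s' [tau [d [_ surv _ _]]]]] :=
  mem_survivors gt1_q forms affine classified mdsX form_i cuts_i XL (k := i).
  by move=> j lt_j; apply: IHi => //; apply: ltn_trans lt_j _.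
by rewrite none in surv.
Qed.
End Exclusions.

(** * Linear labels of a cube *)

(* Modulo [q], line [j] consists of the points [(x, x - j, nu x + (1 - nu) (x - j))]. *)
Definition linear_plane q nu : plane :=
  [seq graph q [seq (x + (q - j)) %% q | x <- iota 0 q]
               [seq (nu * x + (q.+1 - nu) * (x + (q - j))) %% q | x <- iota 0 q]
  | j <- iota 0 q].

Section LinearPlane.
Variable q : nat.
Hypothesis prime_q : prime q.
Local Open Scope ring_scope.

Lemma Fp_nat_inj : {in gtn q &, injective (fun x : nat => x%:R : 'F_q)}.
Proof.
move=> x y lt_x lt_y /(congr1 (fun z : 'F_q => z : nat)).
by rewrite !val_Fp_nat // !modn_small.
Qed.

Lemma linear_plane_word nu p j : (nu <= q.+1)%N ->
  rcons p j \in plane_words (linear_plane q nu) ->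
  (ap p 0)%:R - (ap p 1)%:R = j%:R :> 'F_q /\
  (ap p 2)%:R = nu%:R * (ap p 0)%:R + (1 - nu%:R) * (ap p 1)%:R :> 'F_q.
Proof.
move=> le_nu; rewrite mem_plane_words size_map size_iota => /andP[lt_j].
rewrite nth_map_iota // => /mapP[x + ->]; rewrite mem_iota0 => lt_x /=.
rewrite !nth_map_iota // !Fp_nat_mod // !(natrD, natrM, natrB) ?(ltnW lt_j) //.
by rewrite -[q.+1%:R]natr1 pchar_Fp_0 //; split; ring.
Qed.

Lemma linear_plane_diff nu a b : (nu <= q.+1)%N -> nu%:R != 0 :> 'F_q -> nu%:R != 1 :> 'F_q ->
  (a < 3)%N -> (b < 3)%N -> a != b -> exists2 c : 'F_q, c != 0 &
  forall p j, rcons p j \in plane_words (linear_plane q nu) ->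
    (ap p a)%:R - (ap p b)%:R = c * j%:R :> 'F_q.
Proof.
move=> le_nu nu0 nu1 lt_a lt_b ne_ab.
pose slope i : 'F_q := nth 0 [:: 1; 0; nu%:R] i.
exists (slope a - slope b) => [|p j /(linear_plane_word le_nu)[<- eq_p2]].
  rewrite subr_eq0 /slope; case: a b lt_a lt_b ne_ab => [|[|[|]]] // [|[|[|]]] // _ _ _ /=;
  by rewrite ?oner_eq0 // eq_sym ?oner_eq0.
rewrite /slope; case: a b lt_a lt_b ne_ab => [|[|[|]]] // [|[|[|]]] // _ _ _ /=;
by rewrite ?eq_p2; ring.
Qed.
End LinearPlane.

Definition injective_label q (u : nat -> 'F_q) : Prop := {in gtn q &, injective u}.

(* The slices [x4 = a] and [x3 = b] share the labels [u0] and [u1]. *)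
Definition linearly_labelled q (X : word -> Prop) a b : Prop :=
  exists u0 u1 u2 v1 v2 t : nat -> 'F_q,
  [/\ injective_label u0, injective_label u1, injective_label u2, injective_label v1
    & injective_label v2 /\ injective_label t] /\
  forall w, X w ->
    [/\ (ap w 4 = a -> u0 (ap w 0) - u1 (ap w 1) = v1 (ap w 3))%R,
        (ap w 4 = a -> u0 (ap w 0) - u2 (ap w 2) = v2 (ap w 3))%R
      & (ap w 3 = b -> u0 (ap w 0) - u1 (ap w 1) = t (ap w 4))%R].

(* A cube with the linear plane [L] in the slice [x4 = 0] can have a normal form in the
   slice [x3 = 0] only without a renaming of its first three symbols. *)
Definition rigid_plane q (phis : seq plane) nlin (L : plane) : bool :=
  cuts_wf q L && all (fun h => h.2 == iota 0 q) (survivors q phis nlin L nlin).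

Section CubeLabels.
Variables (q : nat) (phis : seq plane) (nlin : nat).
Hypotheses (prime_q : prime q) (forms : all (normal_form q) phis).
Hypothesis affine : all (affine_invariant q) (drop nlin phis).
Hypothesis classified : classifies q phis.
Hypothesis nonlinear_excluded : forall i, i < nlin -> excluded q (nth [::] phis i).
Hypothesis linear : forall i, nlin <= i < size phis -> exists nu,
  [/\ nth [::] phis i = linear_plane q nu, nu <= q.+1, (nu%:R != 0 :> 'F_q)%R
    & (nu%:R != 1 :> 'F_q)%R].
Hypothesis rigid : all (rigid_plane q phis nlin) (drop nlin phis).
Let gt1_q : 1 < q := prime_gt1 prime_q.
Let gt0_q : 0 < q := ltnW gt1_q.

Let form i : i < size phis -> normal_form q (nth [::] phis i).
Proof. by move=> lt_i; apply: (all_nthP [::] forms). Qed.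

Local Open Scope ring_scope.

Lemma cube_plane_words X L w : mds q 5 3 X -> normal_form q L ->
  contains_plane X L -> X (rcons w 0%N) -> w \in plane_words L.
Proof.
move=> mdsX form_L XL Xw; have [overX _ _] := mdsX.
have [size_w lt_w] := overP _ _ _ (overX _ Xw).
rewrite size_rcons in size_w; case: size_w => size_w.
have {}lt_w i : (i < 4)%N -> (ap w i < q)%N.
  by move=> lt_i; have := lt_w i (leqW lt_i); rewrite nth_rcons size_w lt_i.
have [p L_p p0] := normal_form_point form_L (isT : 0 < 3)%N (lt_w 0%N isT) (lt_w 3%N isT).
have [over_p _] := normal_form_word form_L L_p; have [/eqP size_p _] := andP over_p.
suff /rcons_inj[->] : rcons w 0%N = rcons (rcons p (ap w 3)) 0%N by [].
apply: (mds_agree mdsX (isT : positions 5 3 [:: 0; 3; 4]%N) Xw (XL _ L_p)).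
by rewrite /= !nth_rcons !size_rcons size_p size_w /= p0 !eqxx.
Qed.

Section StandardCube.
Variables (X : word -> Prop) (i : nat).
Hypotheses (mdsX : mds q 5 3 X) (lt_i : (i < size phis)%N).
Hypothesis Xi : contains_plane X (nth [::] phis i).

Let le_nlin : (nlin <= i)%N.
Proof.
rewrite leqNgt; apply/negP => /nonlinear_excluded excl_i.
exact: excludedE gt0_q (form lt_i) excl_i mdsX Xi.
Qed.

Lemma last_slice_linear a b : (a < 3)%N -> (b < 3)%N -> a != b -> exists2 c : 'F_q, c != 0 &
  forall w, X w -> ap w 4 = 0%N -> (ap w a)%:R - (ap w b)%:R = c * (ap w 3)%:R.
Proof.
move=> lt_a lt_b ne_ab; have [|nu [def_i le_nu nu0 nu1]] := linear (i := i).
  by rewrite le_nlin.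
have [c c0 diff] := linear_plane_diff prime_q le_nu nu0 nu1 lt_a lt_b ne_ab.
exists c => // w Xw w4; have [overX _ _] := mdsX; have [size_w _] := overP _ _ _ (overX w Xw).
case: w size_w w4 Xw => [|x [|y [|z [|j [|? []]]]]] //= _ -> Xw.
have := cube_plane_words (w := [:: x; y; z; j]) mdsX (form lt_i) Xi Xw.
rewrite def_i => /(diff [:: x; y; z] j) <-.
by case: a b lt_a lt_b {ne_ab diff} => [|[|[|]]] // [|[|[|]]].
Qed.

Lemma next_slice_linear a b : (a < 3)%N -> (b < 3)%N -> a != b ->
  exists (t : 'F_q) d, [/\ t != 0, perm_table q d & forall w, X w ->
    ap w 3 = 0%N -> (ap w a)%:R - (ap w b)%:R = t * (index (ap w 4) d)%:R].
Proof.
move=> lt_a lt_b ne_ab; set L := nth [::] phis i.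
have /andP[cuts_L /allP surv_id] : rigid_plane q phis nlin L.
  apply: (allP rigid); rewrite /L -(subnKC le_nlin) -nth_drop mem_nth // size_drop.
  by rewrite ltn_sub2r // (leq_ltn_trans le_nlin).
have [i' [s [tau [d [lt_i' surv real _]]]]] :=
  mem_survivors gt1_q forms affine classified mdsX (form lt_i) cuts_L Xi nonlinear_excluded.
have /eqP def_tau := surv_id _ surv; rewrite /= in def_tau; subst tau.
have [perm_s _ perm_d _] := real; have [_ lt_i'2] := andP lt_i'.
have [nu [def_i' le_nu nu0 nu1]] := linear lt_i'.
have [lt_sa lt_sb] := (perm_table_lt perm_s lt_a, perm_table_lt perm_s lt_b).
have ne_s : ap s a != ap s b by apply: contra ne_ab => /eqP /(perm_table_inj perm_s lt_a lt_b) ->.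
have [t t0 diff] := linear_plane_diff prime_q le_nu nu0 nu1 lt_sa lt_sb ne_s.
exists t, d; split=> // w Xw w3; have [overX _ _] := mdsX.
have mdsP : mds q 4 2 (slice 3 0%N X) by apply: mds_slice.
have frame_id := frame_nseq (perm_table_iota q).
have [size_w _] := overP _ _ _ (overX w Xw).
have eq_w : insert 3 0%N (omit 3 w) = w.
  by rewrite -[RHS](insert_omit 0%N (_ : 3 < size w)%N) ?w3 ?size_w.
have [|p [j [i'_p def_w]]] := realizes_onto mdsP (form lt_i'2) frame_id real (w := omit 3 w).
  by rewrite /slice eq_w.
have [over_p lt_j] := normal_form_word (form lt_i'2) i'_p.
have [_ lt_p] := overP _ _ _ over_p; have size_s := perm_table_size perm_s.
have w_entry k : (k < 3)%N -> ap w k = ap p (ap s k).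
  move=> lt_k; have -> : ap w k = ap (omit 3 w) k by rewrite nth_omit /bump leqNgt lt_k.
  rewrite def_w nth_rcons size_map size_iota size_s lt_k nth_relabel ?size_s //.
  rewrite /comp_frame map_nseq comp_table_iota ?perm_table_iota // nth_nseq lt_k.
  by rewrite nth_iota0 // lt_p // perm_table_lt.
have -> : ap w 4 = ap d j.
  by rewrite -[ap w 4](nth_omit 0%N 3 w 3) def_w nth_rcons size_map size_iota size_s.
by rewrite (perm_table_indexK perm_d) // !w_entry //; apply: diff; rewrite -def_i'.
Qed.
End StandardCube.

Lemma label_of_table t : perm_table q t -> injective_label (fun x => (index x t)%:R : 'F_q).
Proof.
move=> perm_t x y lt_x lt_y /(Fp_nat_inj prime_q (perm_table_index_lt perm_t lt_x)
  (perm_table_index_lt perm_t lt_y)) eq_xy.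
by rewrite -(perm_table_index perm_t lt_x) eq_xy (perm_table_index perm_t lt_y).
Qed.

Lemma scaled_label c u : c != 0 -> injective_label u ->
  injective_label (fun x => c * u x : 'F_q).
Proof. by move=> c0 inj_u x y lt_x lt_y /(mulfI c0)/(inj_u x y lt_x lt_y). Qed.

Lemma cube_normalised X a b : mds q 5 3 X -> (a < q)%N -> (b < q)%N -> exists i s G,
  [/\ (i < size phis)%N, perm_table 3 s, relabelling 5 q (rcons (rcons s 3) 4) G,
      contains_plane (pullback 5 q (rcons (rcons s 3) 4) G X) (nth [::] phis i)
    & ap (tab G 3) 0 = b /\ ap (tab G 4) 0 = a].
Proof.
move=> mdsX lt_a lt_b.
have mdsP : mds q 4 2 (slice 4 a X) by apply: mds_slice.
have [B [C [perm_B perm_C line_b]]] := plane_line mdsP lt_b.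
have frame_b : frame q [:: iota 0 q; B; C] by rewrite /frame /= perm_table_iota perm_B perm_C.
have [|i [s [tau [d [lt_i real d0]]]]] := classified mdsP lt_b frame_b.
  move=> _ /mapP[x + ->]; rewrite mem_iota0 => lt_x /=; rewrite nth_iota0 //.
  exact: line_b (mem_graph B C lt_x).
have [perm_s perm_tau perm_d P_i] := real; set g := comp_frame _ tau in P_i.
have sg : relabelling 3 q s g := relabelling_frame perm_s perm_tau frame_b.
have sgd := relabelling_rcons sg perm_d.
exists i, s, (rcons (rcons g d) (swap0_table q a)); split; rewrite //= ?nth_swap0_table //.
  exact: relabelling_rcons sgd (perm_swap0_table lt_a).
move=> w i_w; have over_w := over_normal_form (form lt_i) i_w; have [/eqP size_w _] := andP over_w.
split; first by rewrite -(insert_size _ size_w) over_insert.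
rewrite (relabel_rcons _ _ sgd) // nth_swap0_table //.
have /allpairsPdep[j [p [_ _ def_w]]] := i_w; rewrite def_w in i_w size_w *.
rewrite size_rcons in size_w; case: size_w => size_p.
have := P_i _ _ i_w; rewrite /slice insert_size ?size_rcons ?(size_relabel sg) //.
by rewrite (relabel_rcons _ _ sg).
Qed.

Theorem cube_linearly_labelled X a b : mds q 5 3 X -> (a < q)%N -> (b < q)%N ->
  linearly_labelled q X a b.
Proof.
move=> mdsX lt_a lt_b.
have [i [s [G [lt_i perm_s sG X'i [G3 G4]]]]] := cube_normalised mdsX lt_a lt_b.
have mdsX' := mds_pullback sG mdsX; have size_s := perm_table_size perm_s.
have lt_s k : (k < 3)%N -> (ap s k < 3)%N by apply: perm_table_lt.
have inj_s k l : (k < 3)%N -> (l < 3)%N -> k != l -> ap s k != ap s l.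
  by move=> lt_k lt_l; apply: contra => /eqP /(perm_table_inj perm_s lt_k lt_l) ->.
have [c c0 lin1] :=
  last_slice_linear mdsX' lt_i X'i (lt_s 0 isT) (lt_s 1 isT) (inj_s 0 1 isT isT isT).
have [c' c'0 lin2] :=
  last_slice_linear mdsX' lt_i X'i (lt_s 0 isT) (lt_s 2 isT) (inj_s 0 2 isT isT isT).
have [t [e [t0 perm_e lin3]]] :=
  next_slice_linear mdsX' lt_i X'i (lt_s 0 isT) (lt_s 1 isT) (inj_s 0 1 isT isT isT).
have perm_G k : (k < 5)%N -> perm_table q (tab G k) by case/relabellingP: sG => _ _; apply.
pose label k x : 'F_q := (index x (tab G k))%:R.
have labelP k : (k < 5)%N -> injective_label (label k) by move=> /perm_G /label_of_table.
exists (label 0), (label 1), (label 2), (fun x => c * label 3 x), (fun x => c' * label 3 x),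
  (fun x => t * (index (index x (tab G 4)) e)%:R).
split.
  split; try exact: labelP; try exact/scaled_label/labelP.
  split; first exact/scaled_label/labelP.
  apply: scaled_label => // x y lt_x lt_y; have perm4 := perm_G 4 isT.
  move/(label_of_table perm_e (perm_table_index_lt perm4 lt_x) (perm_table_index_lt perm4 lt_y)).
  by move=> eq_xy; rewrite -(perm_table_index perm4 lt_x) eq_xy (perm_table_index perm4).
move=> u Xu; have [overX _ _] := mdsX; have [w over_w def_u] := relabel_surj sG (overX u Xu).
have X'w : pullback 5 q (rcons (rcons s 3) 4) G X w by rewrite /pullback def_u.
have entry k : (k < 5)%N ->
    index (ap u k) (tab G k) = ap w (if (k < 3)%N then ap s k else k).
  move=> lt_k; rewrite -def_u (index_relabel sG over_w) // !nth_rcons size_rcons size_s.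
  by case: k lt_k => [|[|[|[|[|]]]]].
have w4 : ap u 4 = a -> ap w 4 = 0%N.
  by rewrite -(entry 4) // -G4 => ->; rewrite (perm_table_indexK (perm_G 4 isT)).
have w3 : ap u 3 = b -> ap w 3 = 0%N.
  by rewrite -(entry 3) // -G3 => ->; rewrite (perm_table_indexK (perm_G 3 isT)).
by rewrite /label !entry //=; split=> [/w4|/w4|/w3]; [apply: lin1 | apply: lin2 | apply: lin3].
Qed.
End CubeLabels.

(** * Cubes over 5 and 7 symbols *)

Definition linear_planes q (nus : seq nat) : seq plane := [seq linear_plane q nu | nu <- nus].

Section CubesChecked.
Variables (q : nat) (nonlinear : seq plane) (nus : seq nat).
Variables (rs : rectangles) (xs : seq (nat * seq nat * seq table)).
Let phis := nonlinear ++ linear_planes q nus.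
Let nlin := size nonlinear.

Definition cubes_checked : bool :=
  [&& [&& all (fun nu => 1 < nu < q) nus, all (normal_form q) phis & rectangles_wf q rs],
      rectangles_certified q phis rs, rectangles_cover q rs,
      all (affine_invariant q) (linear_planes q nus)
    & exclusions_check q phis nlin xs && all (rigid_plane q phis nlin) (linear_planes q nus)].

Lemma checked_cube_linearly_labelled : prime q -> cubes_checked ->
  forall X a b, mds q 5 3 X -> a < q -> b < q -> linearly_labelled q X a b.
Proof.
move=> prime_q /and5P[/and3P[nontrivial forms wf] certified cover affine /andP[exclusions rigid]].
move=> X a b; have gt1_q := prime_gt1 prime_q.
have drop_phis : drop nlin phis = linear_planes q nus by rewrite drop_size_cat.
have classified := plane_classification gt1_q forms wf certified cover.
have affine_drop : all (affine_invariant q) (drop nlin phis) by rewrite drop_phis.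
apply: (cube_linearly_labelled prime_q forms affine_drop classified) => [|i|]; last 1 first.
- by rewrite drop_phis.
- apply: (excluded_nonlinear gt1_q forms _ affine_drop classified exclusions).
  by rewrite size_cat leq_addr.
case/andP=> le_i; rewrite size_cat size_map -ltn_subLR // -/nlin => lt_i.
exists (nth 0 nus (i - nlin)); rewrite nth_cat ltnNge le_i /= (nth_map 0) //.
have /(_ _ (mem_nth 0 lt_i))/andP[gt1_nu lt_nu] := allP nontrivial.
have ne0 x : x < q -> nth 0 nus (i - nlin) != x -> ((nth 0 nus (i - nlin))%:R != x%:R :> 'F_q)%R.
  by move=> lt_x; apply: contra => /eqP /(Fp_nat_inj prime_q lt_nu lt_x) ->.
split=> //; first by rewrite leqW // ltnW.
  by rewrite (ne0 0) ?(ltnW gt1_q) // -lt0n ltnW.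
by rewrite (ne0 1) // neq_ltn gt1_nu orbT.
Qed.
End CubesChecked.

(* Found by completing the pairs of lines of [rectangles7], up to relabellings that
   preserve the diagonal line. *)
Definition nonlinear_tables7 : seq (seq (table * table)) := [::
 [:: ([::2;3;5;4;6;1;0], [::3;5;6;1;0;2;4]); ([::3;2;0;6;5;4;1], [::6;0;1;4;2;3;5]);
     ([::1;0;4;5;2;6;3], [::4;3;5;0;6;1;2]); ([::6;4;1;0;3;2;5], [::5;6;0;2;1;4;3]);
     ([::5;6;3;2;1;0;4], [::1;2;4;5;3;6;0]); ([::4;5;6;1;0;3;2], [::2;4;3;6;5;0;1])];
 [:: ([::4;3;1;2;0;6;5], [::1;4;3;6;5;2;0]); ([::2;6;4;1;5;0;3], [::4;5;6;0;2;3;1]);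
     ([::1;4;6;5;2;3;0], [::5;2;0;1;3;6;4]); ([::6;0;5;4;3;2;1], [::3;6;4;5;0;1;2]);
     ([::3;5;0;6;1;4;2], [::2;3;1;4;6;0;5]); ([::5;2;3;0;6;1;4], [::6;0;5;2;1;4;3])];
 [:: ([::5;0;6;1;2;3;4], [::4;2;3;5;6;1;0]); ([::1;6;0;5;3;4;2], [::2;4;1;6;0;3;5]);
     ([::6;4;3;2;5;1;0], [::5;6;4;1;2;0;3]); ([::2;3;5;4;6;0;1], [::3;5;0;2;1;6;4]);
     ([::3;2;4;0;1;6;5], [::6;0;5;4;3;2;1]); ([::4;5;1;6;0;2;3], [::1;3;6;0;5;4;2])];
 [:: ([::3;6;0;4;5;2;1], [::2;3;6;1;0;4;5]); ([::5;0;6;2;3;1;4], [::3;2;4;5;1;6;0]);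
     ([::6;5;4;1;2;3;0], [::5;4;3;2;6;0;1]); ([::4;2;3;0;1;6;5], [::6;0;5;4;3;1;2]);
     ([::2;4;1;5;6;0;3], [::1;5;0;6;2;3;4]); ([::1;3;5;6;0;4;2], [::4;6;1;0;5;2;3])];
 [:: ([::1;0;4;5;6;3;2], [::2;5;6;4;1;0;3]); ([::3;2;6;1;5;4;0], [::1;0;5;6;2;3;4]);
     ([::2;3;5;4;0;6;1], [::4;6;0;1;3;2;5]); ([::4;5;0;6;2;1;3], [::5;3;1;0;6;4;2]);
     ([::5;6;1;0;3;2;4], [::6;4;3;2;5;1;0]); ([::6;4;3;2;1;0;5], [::3;2;4;5;0;6;1])];
 [:: ([::6;2;0;5;1;3;4], [::1;0;5;6;3;4;2]); ([::2;6;3;4;5;0;1], [::3;4;6;0;2;1;5]);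
     ([::1;0;5;6;3;4;2], [::6;2;0;5;1;3;4]); ([::5;3;4;1;6;2;0], [::4;5;1;2;0;6;3]);
     ([::3;4;6;0;2;1;5], [::2;6;3;4;5;0;1]); ([::4;5;1;2;0;6;3], [::5;3;4;1;6;2;0])];
 [:: ([::3;0;6;2;5;4;1], [::6;2;5;1;3;0;4]); ([::1;5;0;4;2;6;3], [::2;4;3;6;0;1;5]);
     ([::4;3;5;1;6;2;0], [::3;0;6;5;2;4;1]); ([::5;2;3;6;0;1;4], [::1;6;4;0;5;3;2]);
     ([::6;4;1;5;3;0;2], [::4;5;0;2;1;6;3]); ([::2;6;4;0;1;3;5], [::5;3;1;4;6;2;0])];
 [:: ([::3;6;4;0;5;1;2], [::6;4;1;2;0;3;5]); ([::4;0;1;2;3;6;5], [::3;6;0;4;5;1;2]);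
     ([::2;5;0;4;6;3;1], [::1;3;5;6;2;0;4]); ([::1;4;5;6;2;0;3], [::2;5;6;0;3;4;1]);
     ([::5;3;6;1;0;2;4], [::4;2;3;5;1;6;0]); ([::6;2;3;5;1;4;0], [::5;0;4;1;6;2;3])];
 [:: ([::5;3;1;0;6;4;2], [::6;4;0;1;2;3;5]); ([::2;4;6;1;0;3;5], [::1;6;4;5;3;0;2]);
     ([::6;5;4;2;3;1;0], [::3;0;1;6;5;2;4]); ([::4;0;3;6;5;2;1], [::5;2;6;0;1;4;3]);
     ([::3;2;0;5;1;6;4], [::2;3;5;4;6;1;0]); ([::1;6;5;4;2;0;3], [::4;5;3;2;0;6;1])];
 [:: ([::6;5;0;1;2;4;3], [::4;0;3;6;5;2;1]); ([::5;6;4;2;1;3;0], [::6;3;1;0;2;4;5]);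
     ([::1;4;5;6;3;0;2], [::5;6;4;2;0;1;3]); ([::2;0;3;4;5;6;1], [::1;2;6;5;3;0;4]);
     ([::4;3;1;0;6;2;5], [::3;5;0;4;1;6;2]); ([::3;2;6;5;0;1;4], [::2;4;5;1;6;3;0])];
 [:: ([::3;4;6;0;2;1;5], [::1;5;4;2;3;6;0]); ([::4;6;1;5;0;2;3], [::3;2;0;1;6;4;5]);
     ([::5;2;0;4;6;3;1], [::4;0;5;6;1;2;3]); ([::1;5;4;2;3;6;0], [::2;6;1;5;0;3;4]);
     ([::2;3;5;6;1;0;4], [::6;4;3;0;5;1;2]); ([::6;0;3;1;5;4;2], [::5;3;6;4;2;0;1])];
 [:: ([::1;0;6;4;2;3;5], [::6;3;4;5;0;1;2]); ([::4;6;3;1;5;2;0], [::3;0;5;2;1;6;4]);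
     ([::6;4;0;5;3;1;2], [::5;2;1;0;6;4;3]); ([::2;3;5;0;6;4;1], [::1;4;3;6;2;0;5]);
     ([::3;5;1;2;0;6;4], [::2;6;0;4;5;3;1]); ([::5;2;4;6;1;0;3], [::4;5;6;1;3;2;0])];
 [:: ([::6;3;5;1;0;4;2], [::3;4;0;5;6;2;1]); ([::1;4;3;6;5;2;0], [::2;3;6;0;1;4;5]);
     ([::3;2;4;0;6;1;5], [::1;0;5;4;2;6;3]); ([::4;6;0;5;2;3;1], [::6;5;1;2;3;0;4]);
     ([::2;5;6;4;1;0;3], [::5;6;4;1;0;3;2]); ([::5;0;1;2;3;6;4], [::4;2;3;6;5;1;0])];
 [:: ([::5;4;0;1;6;2;3], [::3;5;6;2;1;4;0]); ([::1;6;3;5;0;4;2], [::5;4;1;6;2;0;3]);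
     ([::6;3;4;2;5;0;1], [::2;6;3;5;0;1;4]); ([::2;0;5;6;3;1;4], [::1;3;4;0;5;6;2]);
     ([::4;2;6;0;1;3;5], [::6;0;5;4;3;2;1]); ([::3;5;1;4;2;6;0], [::4;2;0;1;6;3;5])];
 [:: ([::5;3;1;0;6;4;2], [::6;4;0;1;2;3;5]); ([::1;6;4;2;0;3;5], [::4;5;1;6;3;0;2]);
     ([::2;4;5;6;3;1;0], [::1;6;3;0;5;2;4]); ([::4;0;3;5;2;6;1], [::5;2;6;4;0;1;3]);
     ([::6;5;0;4;1;2;3], [::3;0;5;2;6;4;1]); ([::3;2;6;1;5;0;4], [::2;3;4;5;1;6;0])];
 [:: ([::3;6;1;2;5;0;4], [::4;3;0;5;1;6;2]); ([::6;0;5;4;2;1;3], [::2;4;6;1;0;3;5]);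
     ([::5;2;3;0;6;4;1], [::3;6;1;2;5;0;4]); ([::4;3;0;5;1;6;2], [::6;0;5;4;2;1;3]);
     ([::1;5;4;6;3;2;0], [::5;2;3;0;6;4;1]); ([::2;4;6;1;0;3;5], [::1;5;4;6;3;2;0])];
 [:: ([::3;2;4;1;6;0;5], [::6;0;3;5;1;4;2]); ([::4;5;0;6;3;2;1], [::5;3;1;0;2;6;4]);
     ([::5;3;1;0;2;6;4], [::4;5;0;6;3;2;1]); ([::6;0;3;5;1;4;2], [::3;2;4;1;6;0;5]);
     ([::1;4;6;2;5;3;0], [::2;6;5;4;0;1;3]); ([::2;6;5;4;0;1;3], [::1;4;6;2;5;3;0])];
 [:: ([::1;0;3;2;5;6;4], [::2;4;5;6;0;1;3]); ([::2;4;5;1;6;0;3], [::1;6;4;5;2;3;0]);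
     ([::3;5;6;0;1;4;2], [::4;3;0;1;6;2;5]); ([::4;3;0;6;2;1;5], [::5;2;6;4;3;0;1]);
     ([::5;6;1;4;3;2;0], [::6;5;3;0;1;4;2]); ([::6;2;4;5;0;3;1], [::3;0;1;2;5;6;4])];
 [:: ([::4;5;6;2;0;1;3], [::2;6;4;5;3;0;1]); ([::1;0;3;4;6;2;5], [::3;5;0;6;1;4;2]);
     ([::5;4;0;6;2;3;1], [::4;3;1;0;6;2;5]); ([::6;3;1;0;5;4;2], [::5;4;6;2;0;1;3]);
     ([::2;6;5;1;3;0;4], [::1;2;3;4;5;6;0]); ([::3;2;4;5;1;6;0], [::6;0;5;1;2;3;4])];
 [:: ([::1;2;0;5;3;6;4], [::2;4;3;6;5;0;1]); ([::2;6;4;1;5;0;3], [::6;3;5;4;0;1;2]);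
     ([::4;3;5;2;6;1;0], [::3;0;1;5;2;6;4]); ([::3;5;6;4;0;2;1], [::1;2;4;0;6;3;5]);
     ([::5;0;3;6;1;4;2], [::4;5;6;1;3;2;0]); ([::6;4;1;0;2;3;5], [::5;6;0;2;1;4;3])];
 [:: ([::3;0;4;1;6;2;5], [::5;6;3;0;1;4;2]); ([::1;5;0;6;2;3;4], [::2;3;1;4;5;6;0]);
     ([::6;4;1;2;5;0;3], [::3;5;4;6;0;2;1]); ([::4;2;6;5;3;1;0], [::6;0;5;1;2;3;4]);
     ([::2;3;5;4;0;6;1], [::1;4;6;2;3;0;5]); ([::5;6;3;0;1;4;2], [::4;2;0;5;6;1;3])]].

Definition nonlinear7 : seq plane :=
  [seq diagonal 7 :: [seq graph 7 t.1 t.2 | t <- ts] | ts <- nonlinear_tables7].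

Definition rectangles7 : rectangles := [::
 ([::1;0;3;2;5;6;4], [::
  ([::2;3;0;1;6;4;5], [::]);
  ([::2;3;1;4;6;0;5], [::]);
  ([::2;3;4;5;6;0;1], [::]);
  ([::2;4;0;5;6;1;3], [::]);
  ([::2;4;1;5;6;0;3], [:: (14, [::1;2;0], [::0;1;4;2;3;5;6]); (8, [::2;1;0], [::3;2;5;1;0;4;6]);
       (4, [::1;0;2], [::2;3;5;0;4;1;6]); (8, [::1;2;0], [::0;1;4;2;3;5;6]);
       (4, [::0;1;2], [::1;0;4;3;5;2;6])]);
  ([::2;4;1;5;6;3;0], [::]);
  ([::2;4;1;6;3;0;5], [:: (14, [::1;2;0], [::0;4;2;6;3;1;5]); (8, [::2;0;1], [::0;4;2;3;1;6;5]);
       (8, [::0;2;1], [::3;6;1;0;2;4;5]); (4, [::1;0;2], [::6;3;1;0;2;4;5]);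
       (4, [::0;1;2], [::4;0;2;3;1;6;5])]);
  ([::2;4;6;5;0;3;1], [::]);
  ([::2;4;6;5;1;3;0], [::]);
  ([::2;5;6;1;0;4;3], [:: (1, [::0;1;2], [::2;6;5;4;3;1;0]); (1, [::0;1;2], [::6;5;0;3;2;1;4])]);
  ([::3;2;4;5;6;0;1], [::]);
  ([::5;2;4;6;0;3;1], [:: (13, [::2;0;1], [::3;4;5;0;6;2;1]); (11, [::0;1;2], [::2;5;6;0;4;3;1]);
       (12, [::0;1;2], [::4;1;6;3;5;2;0]); (0, [::1;0;2], [::3;4;1;0;5;2;6]);
       (0, [::1;0;2], [::0;1;3;5;2;4;6]); (11, [::2;0;1], [::1;2;0;5;4;6;3]);
       (8, [::2;1;0], [::5;2;0;1;6;4;3]); (4, [::0;1;2], [::4;1;6;2;5;0;3]);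
       (8, [::1;2;0], [::1;4;6;0;2;5;3]); (8, [::1;0;2], [::2;0;5;6;4;1;3]);
       (4, [::0;2;1], [::2;5;0;1;6;4;3])]);
  ([::5;2;4;6;1;3;0], [:: (18, [::1;0;2], [::2;1;6;4;3;0;5])]);
  ([::5;2;6;1;0;4;3], [::]);
  ([::5;2;6;4;0;3;1], [:: (17, [::0;2;1], [::1;5;6;3;2;0;4])]);
  ([::6;5;1;4;0;3;2], [:: (2, [::1;0;2], [::1;6;4;3;0;5;2]); (3, [::1;0;2], [::0;6;2;4;3;5;1])])]);
 ([::1;0;3;4;5;6;2], [::
  ([::2;3;0;5;6;4;1], [::]);
  ([::2;4;0;1;6;3;5], [::]);
  ([::2;4;0;6;3;1;5], [:: (3, [::0;1;2], [::6;0;5;2;3;4;1]); (1, [::1;0;2], [::3;2;5;1;6;0;4]);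
       (10, [::0;2;1], [::1;5;3;6;2;0;4]); (12, [::0;1;2], [::0;2;3;1;4;6;5]);
       (12, [::0;2;1], [::0;1;4;2;3;5;6]); (10, [::0;1;2], [::2;6;4;5;1;0;3])]);
  ([::2;4;5;1;6;0;3], [:: (11, [::0;2;1], [::2;1;0;6;4;3;5]); (10, [::0;2;1], [::6;3;2;0;5;1;4]);
       (18, [::1;2;0], [::5;3;2;1;4;0;6]); (18, [::0;1;2], [::1;0;3;4;5;2;6])]);
  ([::2;4;5;1;6;3;0], [:: (18, [::1;0;2], [::2;4;5;3;1;0;6]); (18, [::2;1;0], [::4;6;5;0;3;2;1])]);
  ([::2;4;6;0;3;1;5], [::]);
  ([::5;2;1;6;3;4;0], [::]);
  ([::5;4;1;0;6;2;3], [::]);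
  ([::6;2;0;5;1;3;4], [:: (5, [::0;1;2], [::0;5;4;3;1;6;2]); (5, [::0;1;2], [::0;1;2;5;4;3;6]);
       (3, [::0;1;2], [::4;6;2;3;5;0;1])]);
  ([::6;2;0;5;1;4;3], [:: (7, [::0;1;2], [::0;6;1;3;4;2;5])]);
  ([::6;2;0;5;3;1;4], [::]);
  ([::6;2;5;0;1;3;4], [:: (6, [::0;1;2], [::6;5;3;2;1;0;4]); (7, [::0;1;2], [::0;5;2;1;3;4;6])]);
  ([::6;3;5;2;1;0;4], [:: (4, [::1;0;2], [::4;2;6;3;1;0;5]); (4, [::2;0;1], [::1;0;3;6;4;2;5]);
       (1, [::0;1;2], [::4;6;2;3;0;5;1])])]);
 ([::1;2;0;4;5;6;3], [::
  ([::2;0;1;5;6;3;4], [::]);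
  ([::2;0;6;5;1;3;4], [::]);
  ([::2;4;1;0;6;3;5], [::]);
  ([::2;6;3;1;0;4;5], [:: (13, [::2;0;1], [::2;1;6;0;5;4;3])]);
  ([::3;0;4;1;6;2;5], [:: (1, [::1;0;2], [::3;0;6;1;5;4;2])]);
  ([::3;0;4;5;6;2;1], [:: (10, [::2;0;1], [::3;6;0;1;2;5;4]); (11, [::2;0;1], [::3;1;5;0;4;2;6])]);
  ([::3;0;5;2;6;4;1], [:: (0, [::2;1;0], [::5;4;6;0;1;3;2])]);
  ([::3;4;1;5;6;2;0], [:: (19, [::0;1;2], [::0;6;4;3;1;5;2]); (20, [::0;1;2], [::1;0;5;2;6;4;3])]);
  ([::3;6;4;2;1;0;5], [:: (3, [::1;0;2], [::0;1;3;4;5;2;6]); (1, [::0;1;2], [::6;0;5;3;2;1;4])])]);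
 ([::1;2;3;4;5;6;0], [::
  ([::2;0;4;6;1;3;5], [:: (2, [::1;2;0], [::0;1;2;6;5;3;4])]);
  ([::2;0;5;1;6;4;3], [:: (20, [::1;0;2], [::1;4;3;6;0;5;2]); (9, [::0;1;2], [::1;2;6;4;3;0;5]);
       (9, [::0;1;2], [::5;3;2;4;6;1;0]); (9, [::0;1;2], [::1;6;4;3;5;2;0]);
       (20, [::0;2;1], [::0;6;3;5;2;4;1]); (20, [::0;1;2], [::5;2;3;0;6;1;4]);
       (9, [::0;2;1], [::3;2;6;0;4;5;1]); (9, [::0;2;1], [::0;1;2;5;4;6;3]);
       (9, [::0;2;1], [::0;3;6;1;2;4;5])]);
  ([::2;3;4;5;6;0;1], [:: (4, [::1;0;2], [::3;6;2;5;4;1;0]); (4, [::2;0;1], [::4;1;5;2;3;6;0]);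
       (20, [::0;1;2], [::5;1;3;4;0;6;2]); (4, [::1;0;2], [::5;1;4;0;6;3;2]);
       (4, [::2;0;1], [::6;3;0;4;5;1;2]); (20, [::0;1;2], [::0;3;5;6;2;1;4]);
       (20, [::0;1;2], [::1;4;6;0;3;2;5]); (20, [::0;1;2], [::4;0;2;3;6;5;1]);
       (21, [::1;0;2], [::0;1;2;3;4;5;6]); (15, [::0;1;2], [::0;1;3;5;4;2;6]);
       (4, [::1;0;2], [::1;4;0;3;2;6;5]); (4, [::2;0;1], [::2;6;3;0;1;4;5]);
       (4, [::2;0;1], [::0;4;1;5;6;2;3]); (4, [::1;0;2], [::6;2;5;1;0;4;3]);
       (20, [::0;1;2], [::6;2;4;5;1;0;3]); (20, [::0;1;2], [::2;5;0;1;4;3;6]);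
       (4, [::1;0;2], [::4;0;3;6;5;2;1]); (4, [::2;0;1], [::5;2;6;3;4;0;1]);
       (4, [::1;0;2], [::2;5;1;4;3;0;6]); (4, [::2;0;1], [::3;0;4;1;2;5;6]);
       (20, [::0;1;2], [::3;6;1;2;5;4;0]); (4, [::2;0;1], [::1;5;2;6;0;3;4]);
       (4, [::1;0;2], [::0;3;6;2;1;5;4]); (15, [::0;2;1], [::0;5;1;4;6;3;2])]);
  ([::2;3;5;6;0;4;1], [::]);
  ([::2;3;6;5;1;0;4], [::]);
  ([::2;5;0;6;3;4;1], [::]);
  ([::2;6;5;0;1;4;3], [:: (6, [::2;1;0], [::2;3;5;4;0;6;1]); (6, [::0;2;1], [::3;5;2;1;4;6;0]);
       (0, [::0;1;2], [::0;4;3;6;5;2;1]); (0, [::1;2;0], [::1;0;2;6;3;5;4]);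
       (6, [::1;0;2], [::5;2;3;0;1;6;4]); (0, [::2;0;1], [::4;1;5;6;2;3;0])]);
  ([::2;6;5;1;0;3;4], [:: (12, [::2;1;0], [::0;1;5;6;2;4;3]); (13, [::2;1;0], [::1;0;3;5;6;2;4])]);
  ([::3;0;1;6;2;4;5], [:: (10, [::1;0;2], [::5;0;6;3;2;4;1]); (10, [::1;2;0], [::5;2;4;3;0;6;1]);
       (0, [::2;1;0], [::6;2;3;0;4;5;1]); (6, [::2;1;0], [::5;4;1;6;0;3;2]);
       (0, [::2;0;1], [::4;0;3;2;6;5;1]); (6, [::2;0;1], [::5;6;1;4;2;3;0])]);
  ([::3;0;4;5;6;2;1], [:: (3, [::1;0;2], [::3;2;6;1;4;5;0]); (20, [::0;1;2], [::6;3;2;1;4;5;0]);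
       (6, [::2;0;1], [::1;3;0;6;2;4;5]); (6, [::1;0;2], [::0;6;1;3;2;5;4])]);
  ([::3;0;5;6;1;2;4], [:: (12, [::1;2;0], [::0;5;4;2;3;6;1])]);
  ([::3;0;6;5;2;4;1], [:: (20, [::1;0;2], [::3;6;2;5;4;1;0]); (8, [::1;0;2], [::2;3;6;5;1;0;4]);
       (8, [::0;2;1], [::6;2;3;5;1;0;4]); (8, [::2;1;0], [::3;6;2;5;1;0;4]);
       (20, [::0;2;1], [::2;3;6;5;4;1;0]); (20, [::0;1;2], [::2;6;3;0;1;4;5]);
       (8, [::1;2;0], [::2;6;3;0;4;5;1]); (8, [::2;0;1], [::6;3;2;0;4;5;1]);
       (8, [::0;1;2], [::3;2;6;0;4;5;1])]);
  ([::3;4;0;6;1;2;5], [:: (10, [::1;2;0], [::1;0;3;5;4;6;2])]);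
  ([::4;0;1;5;6;2;3], [:: (11, [::1;0;2], [::1;3;5;4;0;6;2]); (11, [::0;1;2], [::5;3;1;2;6;0;4]);
       (6, [::1;2;0], [::6;1;4;3;0;5;2]); (6, [::2;1;0], [::6;4;1;3;2;5;0]);
       (12, [::2;0;1], [::2;6;5;4;1;0;3]); (12, [::0;2;1], [::4;0;1;2;5;6;3]);
       (12, [::0;1;2], [::6;0;3;4;1;2;5]); (12, [::1;0;2], [::0;6;3;2;5;4;1]);
       (6, [::2;1;0], [::0;5;2;3;6;1;4]); (6, [::1;2;0], [::0;2;5;3;4;1;6])]);
  ([::4;0;1;6;2;3;5], [:: (10, [::2;1;0], [::0;6;2;4;3;5;1])]);
  ([::5;0;1;2;6;4;3], [:: (0, [::0;2;1], [::6;1;3;0;5;2;4]); (0, [::0;1;2], [::6;2;0;3;4;1;5]);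
       (3, [::0;1;2], [::4;6;5;2;0;3;1]); (20, [::1;0;2], [::5;4;6;2;0;3;1])]);
  ([::5;0;4;2;6;3;1], [::]);
  ([::5;6;0;1;2;3;4], [:: (15, [::0;1;2], [::0;5;1;4;6;3;2]); (11, [::0;1;2], [::2;0;3;1;5;4;6]);
       (18, [::1;2;0], [::0;1;5;4;3;2;6]); (18, [::0;1;2], [::6;3;5;1;4;0;2]);
       (11, [::1;2;0], [::5;1;0;3;4;2;6]); (18, [::2;0;1], [::4;6;0;5;3;1;2]);
       (11, [::2;0;1], [::3;2;0;6;1;4;5]); (18, [::1;2;0], [::3;4;1;0;6;5;2]);
       (18, [::2;0;1], [::0;2;3;1;6;4;5]); (11, [::1;2;0], [::2;5;4;0;1;6;3]);
       (18, [::0;1;2], [::0;4;6;2;5;1;3]); (11, [::2;0;1], [::2;1;6;5;0;3;4]);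
       (11, [::0;1;2], [::4;2;5;3;0;6;1]); (18, [::2;0;1], [::2;4;5;3;1;6;0]);
       (11, [::2;0;1], [::5;4;2;1;3;6;0]); (18, [::0;1;2], [::5;2;4;0;3;6;1]);
       (11, [::2;0;1], [::0;6;4;3;5;1;2]); (11, [::1;2;0], [::4;0;6;2;3;1;5]);
       (22, [::0;1;2], [::0;1;2;3;4;5;6]); (11, [::1;2;0], [::3;6;5;1;2;0;4]);
       (18, [::0;1;2], [::1;5;0;3;6;2;4]); (11, [::0;1;2], [::6;4;0;5;2;1;3]);
       (16, [::0;1;2], [::0;1;5;4;2;3;6]); (18, [::1;2;0], [::2;3;0;6;5;4;1]);
       (18, [::2;0;1], [::1;3;4;2;0;5;6]); (11, [::1;2;0], [::1;4;3;6;0;5;2]);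
       (11, [::2;0;1], [::4;3;1;0;2;5;6]); (18, [::2;0;1], [::6;1;2;0;5;3;4]);
       (18, [::0;1;2], [::3;0;2;5;1;4;6]); (18, [::1;2;0], [::5;6;3;2;1;0;4]);
       (15, [::0;1;2], [::0;3;2;1;5;6;4]); (11, [::0;1;2], [::3;1;4;2;6;5;0]);
       (18, [::1;2;0], [::6;0;4;3;2;1;5]); (11, [::0;1;2], [::0;5;1;6;3;2;4]);
       (11, [::0;1;2], [::1;6;2;0;4;3;5]); (11, [::0;1;2], [::5;3;6;4;1;0;2]);
       (15, [::0;1;2], [::0;2;6;3;1;4;5]); (18, [::1;2;0], [::4;5;2;1;0;6;3]);
       (18, [::1;2;0], [::1;2;6;5;4;3;0]); (18, [::2;0;1], [::3;5;6;4;2;0;1]);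
       (18, [::0;1;2], [::2;6;1;4;0;3;5]); (11, [::2;0;1], [::6;5;3;2;4;0;1]);
       (11, [::1;2;0], [::0;3;2;5;6;4;1]); (18, [::0;1;2], [::4;1;3;6;2;5;0]);
       (18, [::2;0;1], [::5;0;1;6;4;2;3]); (11, [::1;2;0], [::6;2;1;4;5;3;0]);
       (11, [::2;0;1], [::1;0;5;4;6;2;3])])])].

Definition exclusions7 : seq (nat * seq nat * seq table) := [::
 (0, [::], [::]);
 (0, [::3;1;2;0], [:: [::5;0;4;6;1;2;3]; [::5;6;0;4;3;2;1]; [::5;2;3;0;6;1;4]; [::0;1;2;5;3;4;6]]);
 (0, [::1;3;2;0], [:: [::1;2;0;3;6;5;4]; [::0;5;1;6;2;3;4]; [::2;1;0;4;3;6;5]; [::1;2;0;5;3;4;6]]);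
 (0, [::1;3;2;0], [:: [::1;2;0;4;6;5;3]; [::6;3;5;0;4;2;1]; [::3;4;5;2;6;1;0]; [::1;2;3;5;0;4;6]]);
 (0, [::0;3;2;1], [:: [::0;1;3;5;2;4;6]; [::3;0;1;2;4;5;6]; [::1;6;3;0;4;5;2]; [::2;3;0;1;6;5;4]]);
 (0, [::0;3;2;1], [:: [::0;1;2;5;4;3;6]; [::0;6;2;1;5;3;4]; [::0;2;5;1;6;4;3]; [::0;3;1;2;6;5;4]]);
 (0, [::0;1;2;3], [:: [::4;5;3;1;0;6;2]; [::2;6;4;5;1;3;0]; [::0;1;6;4;2;5;3]; [::2;0;1;3;4;5;6]]);
 (0, [::0;1;2;3], [:: [::0;3;4;1;5;6;2]; [::4;2;3;0;6;5;1]; [::3;4;5;6;1;2;0]; [::2;1;0;3;4;5;6]]);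
 (8, [::], [::]);
 (8, [::1;2;0;3], [:: [::0;1;2;3;4;5;6]; [::6;5;0;1;2;4;3]; [::4;0;3;6;5;2;1]; [::1;2;3;4;0;5;6]]);
 (8, [::3;2;0;1], [:: [::0;3;4;5;1;2;6]; [::0;3;1;4;5;2;6]; [::0;1;2;3;4;6;5]; [::0;1;4;2;3;5;6]]);
 (8, [::3;2;0;1], [:: [::0;1;3;2;4;5;6]; [::1;0;2;4;6;3;5]; [::6;0;1;3;5;2;4]; [::1;0;4;2;3;5;6]]);
 (8, [::3;0;1;2], [:: [::0;6;4;5;2;1;3]; [::1;2;0;3;6;5;4]; [::2;5;0;1;3;4;6]; [::2;5;0;3;1;6;4]]);
 (8, [::3;2;0;1], [:: [::0;3;4;5;1;2;6]; [::5;1;4;6;2;0;3]; [::3;5;6;2;1;0;4]; [::1;2;5;3;4;0;6]]);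
 (14, [::], [::]);
 (14, [::3;1;2;0], [:: [::0;1;3;4;5;2;6]; [::0;3;4;6;5;1;2]; [::0;4;6;2;3;5;1]; [::0;1;4;2;3;5;6]]);
 (14, [::3;1;2;0], [:: [::0;1;2;3;4;5;6]; [::3;4;1;5;6;2;0]; [::6;5;2;4;3;1;0]; [::1;2;5;3;4;6;0]]);
 (17, [::], [::]);
 (17, [::0;1;2;3], [:: [::0;4;5;1;2;3;6]; [::4;0;1;5;6;2;3]; [::2;3;0;6;4;5;1]; [::1;0;2;3;4;5;6]]);
 (19, [::], [::]);
 (19, [::0;1;2;3], [:: [::0;1;3;2;4;5;6]; [::3;0;1;4;6;2;5]; [::5;6;0;3;1;4;2]; [::1;0;2;3;4;5;6]])
].

(* Permuting the coordinates acts on the slopes with orbits [2; 4; 6] and [3; 5]. *)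
Lemma cubes7_checked : cubes_checked 7 nonlinear7 [:: 2; 3] rectangles7 exclusions7.
Proof. by vm_cast_no_check (erefl true). Qed.

Definition rectangles5 : rectangles := [::
 ([::1;0;3;4;2], [:: ([::2;3;4;0;1], [::])]);
 ([::1;2;3;4;0], [:: ([::2;0;4;1;3], [::]);
     ([::2;3;4;0;1], [:: (0, [::1;0;2], [::0;1;2;3;4])])])].

Lemma cubes5_checked : cubes_checked 5 [::] [:: 2] rectangles5 [::].
Proof. by vm_cast_no_check (erefl true). Qed.

(** * Gluing the labels of a code *)

Section AffineLabels.
Local Open Scope ring_scope.
Variable q : nat.
Hypothesis prime_q : prime q.
Notation F := 'F_q.

Lemma Fp_lt (a : F) : (a < q)%N.
Proof. by rewrite -[ltnRHS](Fp_cast prime_q). Qed.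

Lemma injective_label_inj (u : nat -> F) : injective_label u -> injective (fun a : F => u a).
Proof. by move=> inj_u a b /(inj_u _ _ (Fp_lt a) (Fp_lt b)) /val_inj. Qed.

(* By [f (a + b) = f a + f b - f 0], the map [f - f 0] is additive, hence linear over
   a prime field. *)
Lemma separable_sum_affine (f g h : F -> F) : (forall a b, h (a + b) = f a + g b) ->
  forall a, f a = (f 1 - f 0) * a + f 0.
Proof.
move=> sum_fg; have fD a b : f (a + b) = f a + f b - f 0.
  have -> : f (a + b) = h (a + b + 0) - g 0 by rewrite sum_fg addrK.
  have -> : f b = h (b + 0) - g 0 by rewrite sum_fg addrK.
  have -> : h (b + 0) = f 0 + g b by rewrite addr0 -{1}[b]add0r sum_fg.
  by rewrite addr0 sum_fg; ring.
move=> a; rewrite -[a]natr_Zp; elim: (nat_of_ord a) => [|n IHn]; first by rewrite mulr0 add0r.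
by rewrite -natr1 fD IHn; ring.
Qed.

Definition affinely_equivalent (l l1 : F -> F) : Prop :=
  exists al be, al != 0 /\ forall a, l1 a = al * l a + be.

Lemma affinely_equivalent_trans l l1 l2 :
  affinely_equivalent l l1 -> affinely_equivalent l1 l2 -> affinely_equivalent l l2.
Proof.
case=> al [be [al_neq0 l1E]] [al' [be' [al'_neq0 l2E]]].
exists (al' * al), (al' * be + be'); rewrite mulf_neq0 //; split=> // a.
by rewrite l2E l1E; ring.
Qed.

Lemma square_labels_unique (l m t l1 m1 t1 : F -> F) (pt : F -> F -> F) :
  injective l -> injective m -> injective t -> injective l1 ->
  (forall a b, l a + m b = t (pt a b)) -> (forall a b, l1 a + m1 b = t1 (pt a b)) ->
  affinely_equivalent l l1 /\ affinely_equivalent t t1.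
Proof.
move=> /injF_bij[l' lK l'K] /injF_bij[m' mK m'K] /injF_bij[t' tK _] inj_l1 sum_lm sum_lm1.
have sum1 a b : t1 (t' (a + b)) = l1 (l' a) + m1 (m' b).
  by rewrite -{1}(l'K a) -{1}(m'K b) sum_lm tK sum_lm1.
pose al := l1 (l' 1) - l1 (l' 0).
have l1E a : l1 (l' a) = al * a + l1 (l' 0).
  exact: (@separable_sum_affine (l1 \o l') (m1 \o m') (t1 \o t')).
have al0 : al != 0.
  by rewrite subr_eq0 (inj_eq inj_l1) (can_eq l'K) oner_eq0.
split; first by exists al, (l1 (l' 0)); split=> // a; rewrite -[in LHS](lK a) l1E.
exists al, (l1 (l' 0) + m1 (m' 0)); split=> // a.
by rewrite -[in LHS](tK a) -[t a in LHS]addr0 sum1 l1E; ring.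
Qed.
End AffineLabels.

Section Gluing.
Local Open Scope ring_scope.
Variables (q n k : nat) (C : {set 'rV['F_q]_n}).
Notation F := 'F_q.
Implicit Types (x y z : 'rV[F]_n) (c i j p : 'I_n) (E : seq 'I_n).
Hypotheses (prime_q : prime q) (ge3_k : (3 <= k)%N) (lt_kn : (k.+1 < n)%N).
Hypothesis cubes : forall X a b, mds q 5 3 X -> (a < q)%N -> (b < q)%N -> linearly_labelled q X a b.
Hypothesis card_C : #|C| = (q ^ k)%N.
Hypothesis determined : forall (J : {set 'I_n}) x y, #|J| = k -> x \in C -> y \in C ->
  {in J, forall j, x 0 j = y 0 j} -> x = y.

Lemma codeword_exists (J : {set 'I_n}) (f : 'I_n -> F) : #|J| = k ->
  exists2 x, x \in C & {in J, forall j, x 0 j = f j}.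
Proof.
move=> card_J; pose restrict (h : 'I_n -> F) := [ffun j => if j \in J then h j else 0].
have restrict_on h : restrict h \in pffun_on 0 (mem J) predT.
  apply/pffun_onP; split=> [|a //].
  by apply/subsetP => j; rewrite inE ffunE; case: ifP; rewrite ?eqxx.
pose g (x : 'rV[F]_n) := restrict (x 0).
have inj_g : {in C &, injective g}.
  move=> x y xC yC /ffunP eq_xy; apply: (determined card_J xC yC) => j jJ.
  by have := eq_xy j; rewrite !ffunE jJ.
have sub_C : g @: C \subset pffun_on 0 (mem J) predT.
  by apply/subsetP => _ /imsetP[x _ ->]; apply: restrict_on.
have /subset_cardP/(_ sub_C)/(_ (restrict f)) : #|g @: C| = #|pffun_on (0 : F) (mem J) predT|.
  by rewrite card_in_imset // card_pffun_on card_C card_J cardT -cardE card_Fp.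
rewrite restrict_on => /imsetP[x xC /ffunP eq_x]; exists x => // j jJ.
by have := eq_x j; rewrite !ffunE jJ.
Qed.

Definition info i := (i < k)%N.

Definition agree_except E x y : Prop := forall c, info c -> c \notin E -> x 0 c = y 0 c.

Lemma agree_except_sym E x y : agree_except E x y -> agree_except E y x.
Proof. by move=> xy c info_c nE_c; rewrite xy. Qed.

Lemma agree_except_trans E y x z :
  agree_except E x y -> agree_except E y z -> agree_except E x z.
Proof. by move=> xy yz c info_c nE_c; rewrite xy ?yz. Qed.

Lemma agree_exceptS E E' x y : {subset E <= E'} -> agree_except E x y -> agree_except E' x y.
Proof. by move=> sEE' xy c info_c nE'_c; rewrite xy // (contra (sEE' c)). Qed.

Lemma card_info_except E : uniq E -> all info E ->
  (#|[set c | info c & c \notin E]| + size E)%N = k.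
Proof.
move=> uniq_E /allP info_E; have le_kn : (k <= n)%N by rewrite ltnW // ltnW.
have -> : [set c | info c & c \notin E] = [set c | info c] :\: [set c in E].
  by apply/setP => c; rewrite !inE andbC.
have card_info : #|[set c : 'I_n | info c]| = k.
  have -> : [set c | info c] = widen_ord le_kn @: setT.
    apply/setP => i; rewrite inE; apply/idP/imsetP => [lt_i|[j _ ->]]; last exact: (ltn_ord j).
    by exists (Ordinal lt_i); rewrite ?inE //; apply: val_inj.
  by rewrite card_imset ?cardsT ?card_ord // => a b /(congr1 val)/= /val_inj.
have sub_E : [set c in E] \subset [set c | info c] by apply/subsetP => c; rewrite !inE => /info_E.
have card_E : #|[set c in E]| = size E by rewrite cardsE; apply/card_uniqP.
by rewrite cardsD (setIidPr sub_E) -card_E subnK // subset_leq_card.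
Qed.

Lemma info_determined x y : x \in C -> y \in C -> agree_except [::] x y -> x = y.
Proof.
move=> xC yC xy; have := card_info_except (isT : uniq [::]) isT; rewrite addn0 => card_J.
by apply: (determined card_J xC yC) => j; rewrite inE andbT => info_j; apply: xy.
Qed.

Lemma info_exists f : exists2 x, x \in C & forall j, info j -> x 0 j = f j.
Proof.
have := card_info_except (isT : uniq [::]) isT; rewrite addn0 => /(codeword_exists f)[x xC eq_x].
by exists x => // j info_j; rewrite eq_x // inE info_j.
Qed.

Lemma change_symbol x i a : x \in C -> info i ->
  exists y, [/\ y \in C, y 0 i = a & agree_except [:: i] y x].
Proof.
move=> xC info_i; have [y yC eq_y] := info_exists (fun j => if j == i then a else x 0 j).
exists y; split=> // [|j info_j]; first by rewrite eq_y // eqxx.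
by rewrite inE eq_y // => /negbTE->.
Qed.

(* Any codeword is joined to [x0] by changing one information symbol at a time
   into the corresponding symbol of [x0]. *)
Lemma codeword_ind (Q : 'rV[F]_n -> Prop) x0 : x0 \in C -> Q x0 ->
  (forall x z i, x \in C -> z \in C -> info i -> agree_except [:: i] x z ->
     z 0 i = x0 0 i -> Q z -> Q x) ->
  forall x, x \in C -> Q x.
Proof.
move=> x0C Q_x0 Q_change.
suff Q_upto m : (m <= k)%N -> forall x, x \in C ->
    (forall j, (m <= j)%N -> info j -> x 0 j = x0 0 j) -> Q x.
  by move=> x xC; apply: (Q_upto k) => // j; rewrite leqNgt => /negP.
elim: m => [|m IHm] lt_mk x xC eq_x.
  by rewrite (info_determined xC x0C) // => j info_j _; apply: eq_x.
pose i := Ordinal (leq_trans lt_mk (ltnW (ltnW lt_kn))).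
have [z [zC zi zx]] := change_symbol (x0 0 i) xC (lt_mk : info i).
apply: (Q_change x z i) => //; first exact: agree_except_sym.
apply: IHm => // [|j le_mj info_j]; first exact: ltnW.
have [->//|ne_ji] := eqVneq j i; rewrite zx ?inE // eq_x // ltn_neqAle le_mj andbT.
by apply: contra ne_ji => /eqP eq_mj; apply/eqP/val_inj.
Qed.

Definition subcube cs E x0 (w : word) : Prop :=
  exists x, [/\ x \in C, agree_except E x x0 & w = [seq (x 0 c : nat) | c <- cs]].

Lemma mds_subcube cs E x0 : uniq cs -> uniq E -> all info E ->
  {in cs, forall c, info c -> c \in E} -> mds q (size cs) (size E) (subcube cs E x0).
Proof.
move=> uniq_cs uniq_E info_E cs_E; pose c0 := Ordinal (ltnW lt_kn).
pose fixed := [set c | info c & c \notin E].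
pose known (I : seq nat) := fixed :|: [set c in map (nth c0 cs) I].
have cs_free (i : nat) : (i < size cs)%N -> nth c0 cs i \notin fixed.
  by move=> lt_i; rewrite inE negb_and negbK -implybE; apply/implyP/cs_E/mem_nth.
have read x (i : nat) : (i < size cs)%N -> ap [seq (x 0 c : nat) | c <- cs] i = x 0 (nth c0 cs i).
  by move=> lt_i; rewrite (nth_map c0).
have card_known I : positions (size cs) (size E) I -> #|known I| = k.
  case/and3P=> uniq_I /eqP size_I /allP lt_I; rewrite cardsU.
  have -> : fixed :&: [set c in map (nth c0 cs) I] = set0.
    apply/setP => c; rewrite inE in_set0 [X in _ && X]inE; apply/negP.
    by case/andP=> fixed_c /mapP[i /lt_I/cs_free free def_c]; rewrite -def_c fixed_c in free.
  rewrite cards0 subn0; have -> : #|[set c in map (nth c0 cs) I]| = size E.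
    rewrite cardsE -size_I -(size_map (nth c0 cs)); apply/card_uniqP.
    by rewrite map_inj_in_uniq // => i j /lt_I lt_i /lt_I lt_j /eqP; rewrite nth_uniq // => /eqP.
  exact: card_info_except.
split=> [_ [x [_ _ ->]]|I _ _ posI [x [xC xE ->]] [y [yC yE ->]] eq_xy|I f posI lt_f].
- by rewrite /over size_map eqxx all_map; apply/allP => c _ /=; apply: Fp_lt.
- have /and3P[_ _ /allP lt_I] := posI; suff -> : x = y by [].
  apply: (determined (card_known I posI) xC yC) => c; rewrite !inE.
  case/orP=> [/andP[info_c nE_c]|/mapP[i Ii ->]]; first by rewrite xE ?yE.
  by have lt_i : (i < size cs)%N := lt_I i Ii; have := eq_xy i Ii; rewrite !read // => /val_inj.
have /and3P[_ _ /allP lt_I] := posI.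
have [x xC eq_x] := codeword_exists
  (fun c => if c \in fixed then x0 0 c else (f (index c cs))%:R) (card_known I posI).
exists [seq (x 0 c : nat) | c <- cs] => [|i Ii].
  exists x; split=> // c info_c nE_c.
  by have fixed_c : c \in fixed; rewrite ?inE ?info_c // eq_x ?fixed_c // inE fixed_c.
have lt_i : (i < size cs)%N := lt_I i Ii; rewrite read // eq_x; last by rewrite !inE map_f ?orbT.
by rewrite (negbTE (cs_free i lt_i)) index_uniq // val_Fp_nat // modn_small.
Qed.

Definition plane_labels x i j p (l m t : F -> F) : Prop :=
  [/\ injective l, injective m, injective t
    & forall y, y \in C -> agree_except [:: i; j] y x -> l (y 0 i) + m (y 0 j) = t (y 0 p)].

Lemma plane_labelsC x i j p l m t : plane_labels x i j p l m t -> plane_labels x j i p m l t.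
Proof.
case=> inj_l inj_m inj_t sum_lm; split=> // y yC yx; rewrite addrC sum_lm //.
by apply: agree_exceptS yx => c; rewrite !inE orbC.
Qed.

Lemma plane_labels_agree x z i j p l m t : agree_except [:: i; j] x z ->
  plane_labels x i j p l m t -> plane_labels z i j p l m t.
Proof.
move=> xz [inj_l inj_m inj_t sum_lm]; split=> // y yC yz; apply: sum_lm => //.
exact: agree_except_trans yz (agree_except_sym xz).
Qed.

Lemma cube_labels_exist x0 i j h p p' a b :
  info i -> info j -> info h -> uniq [:: i; j; h] -> ~~ info p -> ~~ info p' -> p != p' ->
  exists u0 u1 u2 v1 v2 t : F -> F,
    [/\ injective u0, injective u1, injective u2, injective v1
      & injective v2 /\ injective t] /\
    forall y, y \in C -> agree_except [:: i; j; h] y x0 ->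
      [/\ y 0 h = a -> u0 (y 0 i) - u1 (y 0 p) = v1 (y 0 j),
          y 0 h = a -> u0 (y 0 i) - u2 (y 0 p') = v2 (y 0 j)
        & y 0 j = b -> u0 (y 0 i) - u1 (y 0 p) = t (y 0 h)].
Proof.
move=> info_i info_j info_h uniq_ijh par_p par_p' ne_pp'.
have info_E : all info [:: i; j; h] by rewrite /= info_i info_j info_h.
have ne_info_par c d : info c -> ~~ info d -> (c == d) = false.
  by move=> info_c par_d; apply: contraNF par_d => /eqP <-.
have uniq_cs : uniq [:: i; p; p'; j; h].
  move: uniq_ijh; rewrite /= !inE !negb_or => /and3P[/andP[-> ->] -> _].
  by rewrite ne_pp' !(eq_sym p) !(eq_sym p') !ne_info_par.
have cs_E : {in [:: i; p; p'; j; h], forall c, info c -> c \in [:: i; j; h]}.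
  move=> c + info_c; rewrite !inE => /or4P[->|/eqP eq_c|/eqP eq_c|->]; rewrite ?orbT //.
    by rewrite -eq_c info_c in par_p.
  by rewrite -eq_c info_c in par_p'.
have [u0 [u1 [u2 [v1 [v2 [t [[inj_u0 inj_u1 inj_u2 inj_v1 [inj_v2 inj_t]] lin]]]]]]] :=
  cubes (mds_subcube x0 uniq_cs uniq_ijh info_E cs_E) (Fp_lt prime_q a) (Fp_lt prime_q b).
exists (fun e : F => u0 e), (fun e : F => u1 e), (fun e : F => u2 e),
  (fun e : F => v1 e), (fun e : F => v2 e), (fun e : F => t e).
split=> [|y yC yx0]; first by do ![split | exact: injective_label_inj].
have [|lin1 lin2 lin3] := lin [seq (y 0 c : nat) | c <- [:: i; p; p'; j; h]]; first by exists y.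
by split=> [yh|yh|yj]; [apply: lin1 | apply: lin2 | apply: lin3]; rewrite /= ?yh ?yj.
Qed.

(* The first two planes are slices of one cube; the third is the first with [p'] in
   place of [p]. *)
Lemma adjacent_planes x0 x1 i j h p p' :
  info i -> info j -> info h -> uniq [:: i; j; h] -> ~~ info p -> ~~ info p' -> p != p' ->
  agree_except [:: i; j; h] x1 x0 ->
  exists l m m1 m2 t t2, [/\ plane_labels x0 i j p l m t, plane_labels x1 i h p l m1 t
    & plane_labels x0 i j p' l m2 t2].
Proof.
move=> info_i info_j info_h uniq_ijh par_p par_p' ne_pp' x10.
have [u0 [u1 [u2 [v1 [v2 [t [[inj_u0 inj_u1 inj_u2 inj_v1 [inj_v2 inj_t]] lin]]]]]]] :=
  cube_labels_exist x0 (x0 0 h) (x1 0 j) info_i info_j info_h uniq_ijh par_p par_p' ne_pp'.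
have inj_opp (u : F -> F) : injective u -> injective (fun e => - u e).
  by move=> inj_u e e' /oppr_inj/inj_u.
have sub_ij : {subset [:: i; j] <= [:: i; j; h]} by move=> c; rewrite !inE orbA => ->.
have sub_ih : {subset [:: i; h] <= [:: i; j; h]}.
  by move=> c; rewrite !inE => /orP[]->; rewrite ?orbT.
have /and3P[] := uniq_ijh; rewrite !inE negb_or => /andP[ne_ij ne_ih] ne_jh _.
exists u0, (fun e => - v1 e), (fun e => - t e), (fun e => - v2 e), u1, u2.
have yh y : agree_except [:: i; j] y x0 -> y 0 h = x0 0 h.
  by move=> ->; rewrite // !inE negb_or !(eq_sym h) ne_ih.
have yj y : agree_except [:: i; h] y x1 -> y 0 j = x1 0 j.
  by move=> ->; rewrite // !inE negb_or eq_sym ne_ij.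
split; split; do ?[exact: inj_opp]; move=> // y yC yx.
- have [lin1 _ _] := lin y yC (agree_exceptS sub_ij yx).
  by rewrite -lin1 ?yh //; ring.
- have [_ _ lin3] := lin y yC (agree_except_trans (agree_exceptS sub_ih yx) x10).
  by rewrite -lin3 ?yj //; ring.
have [_ lin2 _] := lin y yC (agree_exceptS sub_ij yx).
by rewrite -lin2 ?yh //; ring.
Qed.

Lemma other_info E : uniq E -> all info E -> (size E < k)%N -> exists2 h, info h & h \notin E.
Proof.
move=> uniq_E info_E lt_E; have := card_info_except uniq_E info_E.
case: (posnP #|[set c | info c & c \notin E]|) => [->|].
  by move: lt_E => /[swap] <-; rewrite ltnn.
by case/card_gt0P=> h; rewrite inE => /andP[]; exists h.
Qed.

Lemma other_parity p : exists2 p', ~~ info p' & p != p'.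
Proof.
pose a := Ordinal (ltnW lt_kn); pose b := Ordinal lt_kn.
have [->|ne_pa] := eqVneq p a; last by exists a; rewrite // /info /= ltnn.
by exists b; rewrite -?val_eqE /info /= -?leqNgt ?ltn_eqF.
Qed.

Definition plane_coords i j p : bool := [&& info i, info j, i != j & ~~ info p].

Lemma plane_coordsC i j p : plane_coords i j p = plane_coords j i p.
Proof. by rewrite /plane_coords andbCA eq_sym. Qed.

Lemma third_info i j p : plane_coords i j p -> exists2 h, info h & uniq [:: i; j; h].
Proof.
case/and4P=> info_i info_j ne_ij _.
have [||h info_h] := other_info (E := [:: i; j]) _ _ ge3_k;
  rewrite /= ?mem_seq1 ?ne_ij ?info_i ?info_j //.
rewrite !inE negb_or => /andP[ne_hi ne_hj]; exists h => //=.
by rewrite !inE negb_or ne_ij !(eq_sym _ h) ne_hi ne_hj.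
Qed.

Lemma plane_labels_unique x i j p l m t l1 m1 t1 : x \in C -> plane_coords i j p ->
  plane_labels x i j p l m t -> plane_labels x i j p l1 m1 t1 ->
  affinely_equivalent l l1 /\ affinely_equivalent t t1.
Proof.
move=> xC /and4P[info_i info_j ne_ij _] [inj_l inj_m inj_t sum_lm] [inj_l1 _ _ sum_lm1].
have plane_point ab : exists y,
    [/\ y \in C, agree_except [:: i; j] y x, y 0 i = ab.1 & y 0 j = ab.2].
  have [z [zC zi zx]] := change_symbol ab.1 xC info_i.
  have [y [yC yj yz]] := change_symbol ab.2 zC info_j.
  have [sub_i sub_j] : {subset [:: i] <= [:: i; j]} /\ {subset [:: j] <= [:: i; j]}.
    by split=> c; rewrite !inE => ->; rewrite ?orbT.
  exists y; split; rewrite // ?yz ?inE //.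
  exact: agree_except_trans (agree_exceptS sub_j yz) (agree_exceptS sub_i zx).
have [Y YP] := fin_all_exists plane_point.
pose pt a b := Y (a, b) 0 p.
apply: (@square_labels_unique _ l m t l1 m1 t1 pt) => // a b; have [yC yx yi yj] := YP (a, b).
  by have := sum_lm _ yC yx; rewrite yi yj.
by have := sum_lm1 _ yC yx; rewrite yi yj.
Qed.

Lemma plane_labels_exist x i j p : plane_coords i j p -> exists l m t, plane_labels x i j p l m t.
Proof.
move=> ijp; have [h info_h uniq_ijh] := third_info ijp; have [p' par_p' ne_pp'] := other_parity p.
have /and4P[info_i info_j _ par_p] := ijp.
have [l [m [_ [_ [t [_ [labels _ _]]]]]]] :=
  adjacent_planes info_i info_j info_h uniq_ijh par_p par_p' ne_pp' (fun _ _ _ => erefl (x 0 _)).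
by exists l, m, t.
Qed.

Lemma plane_labels_turn x i j j' p l m t l1 m1 t1 : x \in C ->
  plane_coords i j p -> plane_coords i j' p ->
  plane_labels x i j p l m t -> plane_labels x i j' p l1 m1 t1 ->
  affinely_equivalent l l1 /\ affinely_equivalent t t1.
Proof.
move=> xC ijp ij'p labels labels1; have [eq_j|ne_j] := eqVneq j j'.
  by rewrite -eq_j in labels1; apply: plane_labels_unique labels labels1.
have [p' par_p' ne_pp'] := other_parity p.
have [/and4P[info_i info_j ne_ij par_p] /and4P[_ info_j' ne_ij' _]] := (ijp, ij'p).
have uniq_ijj' : uniq [:: i; j; j'] by rewrite /= !inE negb_or ne_ij ne_ij' ne_j.
have [L [M [M1 [M2 [T [T2 [labels_j labels_j' _]]]]]]] :=
  adjacent_planes info_i info_j info_j' uniq_ijj' par_p par_p' ne_pp' (fun _ _ _ => erefl (x 0 _)).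
have [l_L t_T] := plane_labels_unique xC ijp labels labels_j.
have [L_l1 T_t1] := plane_labels_unique xC ij'p labels_j' labels1.
by split; [apply: affinely_equivalent_trans l_L L_l1 | apply: affinely_equivalent_trans t_T T_t1].
Qed.

Lemma info_label_unique x i j j' p p' l m t l1 m1 t1 : x \in C ->
  plane_coords i j p -> plane_coords i j' p' ->
  plane_labels x i j p l m t -> plane_labels x i j' p' l1 m1 t1 -> affinely_equivalent l l1.
Proof.
move=> xC ijp ij'p' labels labels1; have [eq_p|ne_pp'] := eqVneq p p'.
  by rewrite -eq_p in labels1 ij'p'; case: (plane_labels_turn xC ijp ij'p' labels labels1).
have [h info_h uniq_ij'h] := third_info ij'p'.
have [/and4P[info_i _ _ par_p] /and4P[_ info_j' ne_ij' par_p']] := (ijp, ij'p').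
have ij'p : plane_coords i j' p by apply/and4P.
have [L [M [M1 [M2 [T [T2 [labels_p _ labels_p']]]]]]] :=
  adjacent_planes info_i info_j' info_h uniq_ij'h par_p par_p' ne_pp' (fun _ _ _ => erefl (x 0 _)).
have [l_L _] := plane_labels_turn xC ijp ij'p labels labels_p.
have [L_l1 _] := plane_labels_unique xC ij'p' labels_p' labels1.
exact: affinely_equivalent_trans l_L L_l1.
Qed.

Lemma parity_label_unique x i j i' j' p l m t l1 m1 t1 : x \in C ->
  plane_coords i j p -> plane_coords i' j' p ->
  plane_labels x i j p l m t -> plane_labels x i' j' p l1 m1 t1 -> affinely_equivalent t t1.
Proof.
move=> xC ijp i'j'p labels labels1; have [eq_i|ne_ii'] := eqVneq i i'.
  by rewrite -eq_i in labels1 i'j'p; case: (plane_labels_turn xC ijp i'j'p labels labels1).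
have [/and4P[info_i _ _ par_p] /and4P[info_i' _ _ _]] := (ijp, i'j'p).
have ii'p : plane_coords i i' p by apply/and4P.
have [l2 [m2 [t2 labels2]]] := plane_labels_exist x ii'p.
have [_ t_t2] := plane_labels_turn xC ijp ii'p labels labels2.
rewrite plane_coordsC in ii'p.
have [_ t2_t1] := plane_labels_turn xC ii'p i'j'p (plane_labelsC labels2) labels1.
exact: affinely_equivalent_trans t_t2 t2_t1.
Qed.

Definition coordinate_label x c (u : F -> F) : Prop :=
  if info c then exists j p m t, plane_coords c j p /\ plane_labels x c j p u m t
  else exists i j l m, plane_coords i j c /\ plane_labels x i j c l m u.

Lemma coordinate_label_exists x c : exists u, coordinate_label x c u.
Proof.
rewrite /coordinate_label; case info_c: (info c).
  have [||j info_j] := other_info (E := [:: c]) _ _ (ltnW ge3_k); rewrite /= ?info_c //.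
  rewrite inE eq_sym => ne_cj; have [p par_p _] := other_parity c.
  have cjp : plane_coords c j p by apply/and4P.
  by have [l [m [t labels]]] := plane_labels_exist x cjp; exists l, j, p, m, t.
have [i info_i _] := other_info (E := [::]) isT isT (ltnW (ltnW ge3_k)).
have [||j info_j] := other_info (E := [:: i]) _ _ (ltnW ge3_k); rewrite /= ?info_i //.
rewrite inE eq_sym => ne_ij.
have ijc : plane_coords i j c by rewrite /plane_coords info_i info_j ne_ij info_c.
by have [l [m [t labels]]] := plane_labels_exist x ijc; exists t, i, j, l, m.
Qed.

Section CoordinateLabels.
Variables (x0 : 'rV[F]_n) (lam : 'I_n -> F -> F).
Hypotheses (x0C : x0 \in C) (lamP : forall c, coordinate_label x0 c (lam c)).

Lemma coordinate_label_inj c : injective (lam c).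
Proof.
have := lamP c; rewrite /coordinate_label; case: ifP => _.
  by case=> j [p [m [t [_ []]]]].
by case=> i [j [l [m [_ []]]]].
Qed.

(* The label of [i] spreads from [x] to a codeword differing in the symbol [c] through
   the cube of the three information symbols [i], [j], [c]. *)
Lemma plane_labels_equivalent x i j p l m t : x \in C -> plane_coords i j p ->
  plane_labels x i j p l m t -> affinely_equivalent (lam i) l /\ affinely_equivalent (lam p) t.
Proof.
move=> xC; move: x xC i j p l m t; apply: (codeword_ind x0C) => [i j p l m t ijp labels|].
  have /and4P[info_i _ _ par_p] := ijp; split.
    have := lamP i; rewrite /coordinate_label info_i => -[j' [p' [m' [t' [ij'p' labels']]]]].
    exact: info_label_unique x0C ij'p' ijp labels' labels.
  have := lamP p; rewrite /coordinate_label (negbTE par_p) => -[i' [j' [l' [m' [i'j'p labels']]]]].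
  exact: parity_label_unique x0C i'j'p ijp labels' labels.
move=> x z c xC _ info_c xz _ IHz i j p l m t ijp labels.
have [c_ij|] := boolP (c \in [:: i; j]).
  apply: IHz ijp (plane_labels_agree _ labels).
  by apply: agree_exceptS xz => e; rewrite inE => /eqP->.
rewrite !inE negb_or => /andP[ne_ci ne_cj].
have [p' par_p' ne_pp'] := other_parity p; have /and4P[info_i info_j ne_ij par_p] := ijp.
have uniq_ijc : uniq [:: i; j; c] by rewrite /= !inE negb_or ne_ij !(eq_sym _ c) ne_ci ne_cj.
have icp : plane_coords i c p by rewrite /plane_coords info_i info_c eq_sym ne_ci.
have zx : agree_except [:: i; j; c] z x.
  by apply/agree_except_sym/(agree_exceptS _ xz) => e; rewrite !inE => ->; rewrite !orbT.
have [L [M [M1 [M2 [T [T2 [labels_x labels_z _]]]]]]] :=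
  adjacent_planes info_i info_j info_c uniq_ijc par_p par_p' ne_pp' zx.
have [l_L t_T] := plane_labels_unique xC ijp labels_x labels.
have [lam_L lam_T] := IHz _ _ _ _ _ _ icp labels_z.
by split; [apply: affinely_equivalent_trans lam_L l_L | apply: affinely_equivalent_trans lam_T t_T].
Qed.

Let coord x c := lam c (x 0 c).

Lemma plane_affine x i j p : x \in C -> plane_coords i j p -> exists al be ga,
  forall y, y \in C -> agree_except [:: i; j] y x ->
    coord y p = al * coord y i + be * coord y j + ga.
Proof.
move=> xC ijp; have [l [m [t labels]]] := plane_labels_exist x ijp.
have [[a [b [_ lE]]] [a2 [b2 [a2_neq0 tE]]]] := plane_labels_equivalent xC ijp labels.
rewrite plane_coordsC in ijp.
have [[a1 [b1 [_ mE]]] _] := plane_labels_equivalent xC ijp (plane_labelsC labels).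
case: labels => _ _ _ sum_lm.
exists (a / a2), (a1 / a2), ((b + b1 - b2) / a2) => y yC yx.
apply: (mulfI a2_neq0); apply: (addIr b2); rewrite -tE -sum_lm // lE mE /coord.
by field.
Qed.

Lemma slope_transfer p i c s x z y : x \in C -> z \in C -> y \in C -> plane_coords i c p ->
  agree_except [:: c] x z -> agree_except [:: i] y x ->
  (forall y', y' \in C -> agree_except [:: i] y' z ->
     coord y' p - coord z p = s * (coord y' i - coord z i)) ->
  coord y p - coord x p = s * (coord y i - coord x i).
Proof.
move=> xC zC yC icp xz yx slope_z; have /and4P[info_i info_c ne_ic _] := icp.
have [al [be [ga coord_p]]] := plane_affine xC icp.
have [y' [y'C y'i y'z]] := change_symbol (y 0 i) zC info_i.
have [sub_i sub_c] : {subset [:: i] <= [:: i; c]} /\ {subset [:: c] <= [:: i; c]}.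
  by split=> e; rewrite !inE => ->; rewrite ?orbT.
have zx := agree_exceptS sub_c (agree_except_sym xz).
have [coord_yc coord_y'c] : coord y c = coord x c /\ coord y' c = coord z c.
  by rewrite /coord yx ?y'z // inE eq_sym.
have [coord_zi coord_y'i] : coord z i = coord x i /\ coord y' i = coord y i.
  by rewrite /coord xz ?y'i // inE.
have := slope_z y' y'C y'z; rewrite coord_y'i coord_zi => <-.
rewrite (coord_p y yC (agree_exceptS sub_i yx)) (coord_p x xC (fun _ _ _ => erefl)).
rewrite (coord_p y' y'C (agree_except_trans (agree_exceptS sub_i y'z) zx)) (coord_p z zC zx).
by rewrite coord_yc coord_y'c coord_zi coord_y'i; ring.
Qed.

Lemma parity_slope p i : ~~ info p -> info i -> exists s, forall x y, x \in C -> y \in C ->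
  agree_except [:: i] y x -> coord y p - coord x p = s * (coord y i - coord x i).
Proof.
move=> par_p info_i.
have [||j info_j] := other_info (E := [:: i]) _ _ (ltnW ge3_k); rewrite /= ?info_i //.
rewrite inE eq_sym => ne_ij; have ijp : plane_coords i j p by apply/and4P.
have [s [be [ga coord_p]]] := plane_affine x0C ijp.
have sub_i : {subset [:: i] <= [:: i; j]} by move=> e; rewrite !inE => ->.
exists s => x y xC; move: x xC y; apply: (codeword_ind x0C) => [y yC yx|].
  rewrite (coord_p y yC (agree_exceptS sub_i yx)) (coord_p x0 x0C (fun _ _ _ => erefl)).
  have -> : coord y j = coord x0 j by rewrite /coord yx // inE eq_sym.
  by ring.
move=> x z c xC zC info_c xz _ slope_z y yC yx; have [eq_ic|ne_ic] := eqVneq i c.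
  rewrite -eq_ic in xz.
  have -> : coord y p - coord x p = (coord y p - coord z p) - (coord x p - coord z p) by ring.
  by rewrite !slope_z //; [ring | apply: agree_except_trans yx xz].
apply: (slope_transfer xC zC yC _ xz yx) => [|y' y'C]; last exact: slope_z.
by rewrite /plane_coords info_i info_c ne_ic.
Qed.

Lemma parity_affine p : ~~ info p -> exists s : 'I_n -> F, forall x, x \in C ->
  coord x p - coord x0 p = \sum_(i | info i) s i * (coord x i - coord x0 i).
Proof.
move=> par_p.
have slope_exists i : exists s, info i -> forall x y, x \in C -> y \in C ->
    agree_except [:: i] y x -> coord y p - coord x p = s * (coord y i - coord x i).
  have [info_i|_] := boolP (info i); last by exists 0.
  by have [s slope_s] := parity_slope par_p info_i; exists s.
have [s slope_s] := fin_all_exists slope_exists; exists s; apply: (codeword_ind x0C).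
  by rewrite subrr big1 // => i _; rewrite subrr mulr0.
move=> x z c xC zC info_c xz zc; rewrite !(bigD1 c info_c) /= => sum_z.
have coord_zc : coord z c = coord x0 c by rewrite /coord zc.
have -> : coord x p - coord x0 p = (coord x p - coord z p) + (coord z p - coord x0 p) by ring.
rewrite sum_z (slope_s c info_c z x zC xC xz) coord_zc subrr mulr0 add0r; congr (_ + _).
by apply: eq_bigr => i /andP[info_i ne_ic]; rewrite /coord xz ?inE.
Qed.

Lemma labelled_code_linear :
  exists D : {set 'rV[F]_n}, linear_code D /\ code_equiv C D.
Proof.
have inj_shift c : injective (fun a => lam c a - lam c (x0 0 c)).
  by move=> a b /addIr /coordinate_label_inj.
pose pi c := perm (inj_shift c); pose phi x := \row_c pi c (x 0 c).
have phiE x c : phi x 0 c = coord x c - coord x0 c by rewrite mxE permE.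
exists (phi @: C); split; last first.
  exists 1%g, pi; apply: eq_imset => x; apply/rowP => j.
  by rewrite !mxE perm1.
split=> [|a _ _ /imsetP[x xC ->] /imsetP[y yC ->]].
  by apply/imsetP; exists x0 => //; apply/rowP => c; rewrite phiE subrr mxE.
have [w wC w_info] := info_exists (fun c => (pi c)^-1%g (a * phi x 0 c + phi y 0 c)).
have phi_w c : info c -> phi w 0 c = a * phi x 0 c + phi y 0 c.
  by move=> info_c; rewrite mxE w_info // permKV.
apply/imsetP; exists w => //; apply/rowP => p.
have -> : (a *: phi x + phi y) 0 p = a * phi x 0 p + phi y 0 p by rewrite !mxE.
have [/phi_w //|par_p] := boolP (info p); have [s sum_s] := parity_affine par_p.
rewrite !phiE !sum_s // mulr_sumr -big_split /=; apply: eq_bigr => i /phi_w.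
by rewrite !phiE => ->; ring.
Qed.
End CoordinateLabels.

Theorem mds_code_linear : exists D : {set 'rV[F]_n}, linear_code D /\ code_equiv C D.
Proof.
have [x0 x0C _] := info_exists (fun=> 0).
have [lam lamP] := fin_all_exists (coordinate_label_exists x0).
exact: labelled_code_linear x0C lamP.
Qed.
End Gluing.

Lemma hdist_agree (F : finFieldType) n (x y : 'rV[F]_n) (J : {set 'I_n}) :
  {in J, forall j, x 0%R j = y 0%R j} -> hdist x y <= n - #|J|.
Proof.
move=> eq_xy; have -> : n - #|J| = #|~: J| by rewrite [RHS]cardsCs setCK card_ord.
apply: subset_leq_card; apply/subsetP => j; rewrite !inE.
by apply: contraNN => /eq_xy ->.
Qed.

Theorem theorem4 (q k d : nat) (hq : q = 5 \/ q = 7) (hk : (3 <= k)%N) (hd : (3 <= d)%N)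
  (C : {set 'rV['F_q]_(k + d - 1)}) :
  is_code (k + d - 1) (q ^ k) d C ->
  exists D : {set 'rV['F_q]_(k + d - 1)}, linear_code D /\ code_equiv C D.
Proof.
case=> card_C [_ min_C].
have prime_q : prime q by case: hq => ->.
have lt_kn : k.+1 < k + d - 1 by lia.
apply: (mds_code_linear prime_q hk lt_kn _ card_C) => [X a b|J x y card_J xC yC eq_xy].
  case: hq => ->; first exact: (checked_cube_linearly_labelled _ cubes5_checked).
  exact: (checked_cube_linearly_labelled _ cubes7_checked).
apply/eqP/negPn/negP => ne_xy.
have := leq_trans (min_C x y xC yC ne_xy) (hdist_agree eq_xy).
by rewrite card_J; lia.
Qed.
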